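(* Let $0<d<1/2$, let $I\subseteq\mathbb{N}\cup\{0\}$ be fixed, and let $\{\lambda_n^2\}_{n\ge0}$ and $\{\tilde\lambda_n^2\}_{n\ge0}$ be the eigenvalues of the boundary value problems $L=L(d,q_1,q_2,h_1,h_2,a_1,a_2)$ and $\tilde L=L(d,\tilde q_1,q_2,\tilde h_1,h_2,a_1,a_2)$, respectively. Suppose that $\lambda_n=\tilde\lambda_n$ for all $n\in I$, that $\omega_1=\tilde\omega_1$, and that the system $\{\exp(\pm i\lambda_nx)\}_{n\in I}$ is complete in $L_2(-2d,2d)$. Then $q_1=\tilde q_1$ in $L_2(0,d)$ and $h_1=\tilde h_1$.
   Context: Let $d_1=d$, $d_2=1-d$. For real-valued $q_j\in L_2(0,d_j)$ and real $h_j, a_j$ ($j=1,2$) with $a_1>0$, let $L(d,q_1,q_2,h_1,h_2,a_1,a_2)$ denote the boundary value problem with spectral parameter $\lambda^2$: $$-y_j''+q_j(x)y_j=\lambda^2 y_j,\quad x\in(0,d_j),\ j=1,2,$$ $$y_j'(0)-h_jy_j(0)=0\ (j=1,2),\qquad y_2(d_2)=a_1y_1(d_1),\qquad y_2'(d_2)+a_1^{-1}y_1'(d_1)+a_2y_1(d_1)=0.$$ Its spectrum is a countable set of real simple eigenvalues $\{\lambda_n^2\}_{n\ge0}$, numbered so that $\lambda_n^2<\lambda_{n+1}^2$. Standing assumption (achievable by a shift of the spectrum): $\lambda_n>0$ for all $n\ge0$ (and likewise $\tilde\lambda_n>0$). Notation: $\omega_1=h_1+\frac12\int_0^dq_1(x)\,dx$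 and $\tilde\omega_1=\tilde h_1+\frac12\int_0^d\tilde q_1(x)\,dx$. *)

(* Defs.v *)
From HB Require Import structures.
From mathcomp Require Import all_boot all_order all_algebra.
From mathcomp Require Import all_classical all_reals all_analysis.
From mathcomp Require Import complex.

Set Implicit Arguments.
Unset Strict Implicit.
Unset Printing Implicit Defensive.

Import Order.TTheory GRing.Theory Num.Theory numFieldNormedType.Exports.

Local Open Scope classical_set_scope.
Local Open Scope ring_scope.
Local Open Scope complex_scope.

Section Defs.
Context {R : realType}.

Local Notation mu := (@lebesgue_measure R).

(* Functions on an interval are total functions on R of which only the values
   on the interval matter; f \_ D is f on D and 0 outside D. *)
Definition in_L2 (D : set R) (f : R -> R) : Prop := f \_ D \in Lfun mu 2%:E.

Definition in_CL2 (D : set R) (f : R -> R[i]) : Prop :=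
  in_L2 D (@complex.Re R \o f) /\ in_L2 D (@complex.Im R \o f).

(* f is absolutely continuous on [0, b] with (a.e.) derivative g. *)
Definition AC_deriv (b : R) (f g : R -> R) : Prop :=
  mu.-integrable `]0, b[ (EFin \o g) /\
  forall x, 0 <= x <= b -> f x = f 0 + \int[mu]_(t in `]0, x[) g t.

Definition CAC_deriv (b : R) (f g : R -> R[i]) : Prop :=
  AC_deriv b (@complex.Re R \o f) (@complex.Re R \o g) /\
  AC_deriv b (@complex.Im R \o f) (@complex.Im R \o g).

(* y solves - y'' + q y = z y on (0, b) with y and y' = y1 absolutely
   continuous on [0, b]; as y1 is continuous, y is C^1 on [0, b] and y1 is its
   derivative everywhere, one-sided at the endpoints. *)
Definition SL_solution (b : R) (q : R -> R) (z : R[i]) (y y1 : R -> R[i]) :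
    Prop :=
  exists y2 : R -> R[i],
    [/\ CAC_deriv b y y1,
        CAC_deriv b y1 y2 &
        {ae mu, forall x, x \in `]0, b[ ->
           - y2 x + (q x)%:C * y x = z * y x}].

(* z = lambda^2; u, v are the components y_1, y_2 of an eigenfunction. *)
Definition eigenvalue_L (d : R) (q1 q2 : R -> R) (h1 h2 a1 a2 : R) (z : R[i]) :
    Prop :=
  exists u u' v v' : R -> R[i],
    [/\ SL_solution d q1 z u u' /\ SL_solution (1 - d) q2 z v v',
        u' 0 - h1%:C * u 0 = 0 /\ v' 0 - h2%:C * v 0 = 0,
        v (1 - d) = a1%:C * u d,
        v' (1 - d) + (a1^-1)%:C * u' d + a2%:C * u d = 0 &
        (exists2 x, 0 <= x <= d & u x != 0) \/
        (exists2 x, 0 <= x <= 1 - d & v x != 0)].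

(* lam n > 0 is the normalization obtained by a shift of the spectrum. *)
Definition eigenvalue_seq (d : R) (q1 q2 : R -> R) (h1 h2 a1 a2 : R)
    (lam : nat -> R) : Prop :=
  [/\ forall n, 0 < lam n,
      forall n, lam n ^+ 2 < lam n.+1 ^+ 2 &
      [set z | eigenvalue_L d q1 q2 h1 h2 a1 a2 z] =
      range (fun n => (lam n ^+ 2)%:C)].

Definition omega (d : R) (q : R -> R) (h : R) : R :=
  h + 2^-1 * \int[mu]_(x in `]0, d[) q x.

Definition expi (t : R) : R[i] := cos t +i* sin t.

Definition exp_comb (lam : nat -> R) (s : seq nat) (c c' : nat -> R[i])
    (x : R) : R[i] :=
  \sum_(n <- s) (c n * expi (lam n * x) + c' n * expi (- (lam n * x))).

(* Completeness of a system = density of its (complex) linear span. *)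
Definition exp_complete (a b : R) (I : set nat) (lam : nat -> R) : Prop :=
  forall f : R -> R[i], in_CL2 `]a, b[ f ->
  forall e : R, 0 < e ->
  exists (s : seq nat) (c c' : nat -> R[i]),
    [set` s] `<=` I /\
    ('N[mu]_2%:E[EFin \o
       ((fun x : R => ComplexField.Normc.normc (f x - exp_comb lam s c c' x)%R)
         \_ `]a, b[)] < e%:E)%E.

End Defs.

(* Main.v *)
Require Import Defs.
From mathcomp Require Import all_boot all_order all_algebra.
From mathcomp Require Import all_classical all_reals all_analysis.
From mathcomp Require Import measurable_realfun.
From mathcomp Require Import complex ring lra.

Set Implicit Arguments.
Unset Strict Implicit.
Unset Printing Implicit Defensive.

Import Order.TTheory GRing.Theory Num.Theory numFieldNormedType.Exports.

Local Open Scope classical_set_scope.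
Local Open Scope ring_scope.

(** Only the common eigenvalues matter.  Let phi and tphi be the solutions for
    q1 and tq1 that satisfy the boundary condition at 0 with value 1.  At a
    common eigenvalue lam^2 the matching conditions at the interior point force
    the Wronskian of phi and tphi at d to be, up to a factor, that of two
    solutions of one equation on the second interval, which is 0; so, with
    r = tq1 - q1,
      th1 - h1 + int_0^d r phi tphi = 0.
    The transformation operator phi(x) = cos(lam x) + int K(x,t) cos(lam t) dt,
    obtained by iterating the Volterra equation of phi, gives
      phi tphi = 1/2 + cos(2 lam x) / 2 + int V(x,u) cos(lam u) du
    with V bounded and supported in |u| <= 2x.  As omega_1 agrees, the function
      G(u) = r(u/2) / 4 + int r(x) V(x,u) dx
    is orthogonal to cos(lam_n u) for n in I, so its even part vanishes by
    completeness; that is a homogeneous Volterra equation, whence r = 0. *)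

(** * Integrals over the real line *)

Section Toolbox.
Context {R : realType}.
Local Notation mu := (@lebesgue_measure R).
(* The measurable space on which lebesgue_measure lives; it is convertible to R
   with its own Borel structure, but rewriting and unification tell them apart. *)
Local Notation Rm := (measurableTypeR R).

(** The order of quantifiers shapes the proof. Completeness is applied to a single function G, so K,
    V and all their bounds must be fixed before the eigenvalue is chosen; the Volterra equation is
    therefore iterated on kernels, with estimates free of lam, and not on the solutions themselves.
    The constant 1/2 in the product phi tphi is not the cosine transform of an integrable function.
    Paired with r it contributes half the integral of r, and equality of the two omegas is what
    cancels this against th1 - h1. The light cone |u| < 2x with x < d explains the interval (-2d,
    2d). It also fixes the direction of the final Volterra equation: at u = 2s only x > s
    contributes, so uniqueness runs backward from x = d. Passing to the even part loses nothing.
    Since r is extended by 0, the reflected term r(-u/2) vanishes for u > 0, and sines are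
    orthogonal to every even function, so orthogonality to cosines extends to all exponentials of
    the system. *)

Definition integ (f : R -> R) : Prop := mu.-integrable setT (EFin \o f).

Lemma integ_measurable f : integ f -> measurable_fun (setT : set Rm) f.
Proof. by move=> /(measurable_int mu) /measurable_EFinP. Qed.

Lemma integ_dom (f g : R -> R) : measurable_fun (setT : set Rm) f -> integ g ->
  (forall x, `|f x| <= g x) -> integ f.
Proof.
move=> mf ig fg; apply: (le_integrable measurableT _ _ ig) => //.
  exact/measurable_EFinP.
move=> x _ /=; rewrite lee_fin (le_trans (fg x))// ler_norm//.
Qed.

Lemma integD f g : integ f -> integ g -> integ (fun x => f x + g x).
Proof. by move=> fi gi; exact: (integrableD measurableT fi gi). Qed.

Lemma integB f g : integ f -> integ g -> integ (fun x => f x - g x).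
Proof. by move=> fi gi; exact: (integrableB measurableT fi gi). Qed.

Lemma integZl c f : integ f -> integ (fun x => c * f x).
Proof. by move=> fi; exact: (integrableZl measurableT c fi). Qed.

Lemma integ_norm f : integ f -> integ (fun x => `|f x|).
Proof. by move=> fi; exact: (integrable_norm fi). Qed.

Lemma integ_itv a b : integ (fun x => if (a < x < b) then 1 else 0).
Proof.
rewrite /integ; have -> : (fun x : R => if a < x < b then 1 : R else 0) =
    \1_(`]a,b[%classic : set Rm).
  apply/funext => x; rewrite indicE; case: ifPn => h.
    by rewrite mem_set//= in_itv.
  by rewrite memNset//= in_itv/=; exact/negP.
exact: integrable_indic_itv.
Qed.

(** Tonelli applies to the positive and negative parts separately, and [fine] is measurable; so the
    lemma can be used before integrability in the second variable is established. *)
Lemma measurable_Rintegral d (T : measurableType d) (f : T * Rm -> R) :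
  measurable_fun setT f -> measurable_fun setT (fun x => \int[mu]_y f (x, y)).
Proof.
move=> mf; have mF : measurable_fun setT (EFin \o f) by exact/measurable_EFinP.
apply: (measurableT_comp (fine_measurable measurableT)) => //.
rewrite [X in measurable_fun _ X](_ : _ =
   ((fubini_F mu ((EFin \o f)^\+)%E) \- (fubini_F mu ((EFin \o f)^\-)%E))%E); last first.
  apply/funext => x; rewrite [LHS]integralE.
  rewrite /fubini_F/=; congr (_ - _)%E; apply: eq_integral => y _.
    by rewrite (funepos_comp (EFin \o f) (fun y => (x, y))).
  by rewrite (funeneg_comp (EFin \o f) (fun y => (x, y))).
by apply: emeasurable_funB; apply: measurable_fun_fubini_tonelli_F => //;
  [exact: measurable_funepos|exact: measurable_funeneg].
Qed.

Lemma integ_param (f : Rm * Rm -> R) (a b : R -> R) x :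
  measurable_fun setT f -> integ b ->
  (forall x y, `|f (x, y)| <= a x * b y) -> integ (fun y => f (x, y)).
Proof.
move=> mf ib fab; apply: (integ_dom _ (integZl (a x) ib)) => //.
exact: measurableT_comp.
Qed.

Lemma EFin_Rintegral f : integ f -> (\int[mu]_x f x)%:E = (\int[mu]_x (f x)%:E)%E.
Proof. by move=> fi; rewrite fineK//; exact: integrable_fin_num. Qed.

(** Domination by a product of two integrable functions gives integrability on the plane at once.
    The kernels below all admit such a bound, because of their supports. *)
Lemma Rintegral_Fubini (f : Rm * Rm -> R) (a b : R -> R) :
  measurable_fun setT f -> integ a -> integ b ->
  (forall x y, `|f (x, y)| <= a x * b y) ->
  \int[mu]_x \int[mu]_y f (x, y) = \int[mu]_y \int[mu]_x f (x, y).
Proof.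
move=> mf ia ib fab; have mF : measurable_fun setT (EFin \o f) by exact/measurable_EFinP.
have i1 x : integ (fun y => f (x, y)) by exact: (integ_param _ mf ib fab).
have i2 y : integ (fun x => f (x, y)).
  apply: (integ_dom _ (integZl (b y) ia)) => [|x].
    exact: measurableT_comp.
  by rewrite mulrC.
have fint : (mu \x mu)%E.-integrable setT (EFin \o f).
  apply/(integrable12ltyP mu mu mF).
  have ia' := integ_norm ia; have ib' := integ_norm ib.
  apply: (@le_lt_trans _ _ (\int[mu]_x ((`|a x| * \int[mu]_y `|b y|))%:E)%E); last first.
    rewrite -EFin_Rintegral ?ltry//; under [X in integ X]eq_fun do rewrite mulrC.
    exact: integZl.
  apply: ge0_le_integral => //=.
  - by move=> x _; exact: integral_ge0.
  - apply: (measurable_fun_fubini_tonelli_F (abse \o (EFin \o f))) => //=.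
    exact: measurableT_comp.
  - apply/measurable_EFinP; apply: measurable_funM => //; exact: integ_measurable.
  - move=> x _; rewrite EFinM EFin_Rintegral// -ge0_integralZl//=; last first.
      by apply/measurable_EFinP; exact: integ_measurable.
    apply: ge0_le_integral => //=.
    + by apply/measurable_EFinP; apply: measurableT_comp => //; exact: integ_measurable.
    + apply/measurable_EFinP; apply: measurable_funM => //; exact: integ_measurable.
    + by move=> y _; rewrite -EFinM lee_fin -normrM (le_trans (fab x y))// ler_norm.
have := Fubini fint; rewrite /Rintegral /=.
under eq_integral => x _ do rewrite -EFin_Rintegral//.
move=> ->; congr fine; apply: eq_integral => y _.
by rewrite fineK//; exact: integrable_fin_num (i2 y).
Qed.

(** The pushforward of [mu] scaled by |a| agrees with [mu] on half-open intervals, which determines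
    it. For a < 0 the preimage is closed at the other end, hence the two cases. *)
Lemma lebesgue_measure_affine (a b : R) (A : set Rm) : a != 0 -> measurable A ->
  mu A = (`|a|%:E * mu ((fun x : R => (a * x + b)%R : R) @^-1` A))%E.
Proof.
move=> a0 mA.
have mphi : measurable_fun (setT : set Rm) (fun x : Rm => (a * x + b)%R : Rm).
  by apply: measurable_funD => //; apply: measurable_funM.
have := @lebesgue_measure_unique R (mscale (NngNum (normr_ge0 a))
  (measure_function_pushforward__canonical__measure_function_Measure mu mphi)).
apply => // _ [[u v]] _ <-.
transitivity (`|a|%:E * mu ((fun x : Rm => (a * x + b)%R : Rm) @^-1` `]u, v]))%E => //.
have [a_gt0|a_lt0|E] := ltgtP 0 a; last by rewrite -E eqxx in a0.
- have -> : (fun x : Rm => (a * x + b)%R : Rm) @^-1` `]u, v] = `](u - b) / a,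
    (v - b) / a]%classic.
    apply/seteqP; split => x /=; rewrite !in_itv/= ltr_pdivrMr// ler_pdivlMr//;
    by rewrite ltrBlDr lerBrDr (mulrC x).
  rewrite !lebesgue_measure_itv /= !lte_fin ltr_pM2r ?invr_gt0// ltrD2r gtr0_norm//.
  case: ifPn => _; last by rewrite mule0.
  by rewrite -!EFinB -EFinM; congr EFin; field; rewrite gt_eqF.
- have -> : (fun x : Rm => (a * x + b)%R : Rm) @^-1` `]u, v] = `[(v - b) / a,
    (u - b) / a[%classic.
    apply/seteqP; split => x /=; rewrite !in_itv/= ltr_ndivlMr// ler_ndivrMr//;
    by rewrite ltrBlDr lerBrDr (mulrC x) andbC.
  rewrite !lebesgue_measure_itv /= !lte_fin ltr_nM2r ?invr_lt0// ltrD2r ltr0_norm//.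
  case: ifPn => _; last by rewrite mule0.
  by rewrite -!EFinB -EFinM; congr EFin; field; rewrite lt_eqF.
Qed.

Lemma ge0_integral_affine (a b : R) (f : Rm -> \bar R) : a != 0 ->
  measurable_fun setT f -> (forall x, 0 <= f x)%E ->
  (\int[mu]_x f (a * x + b)%R = (`|a|^-1)%:E * \int[mu]_x f x)%E.
Proof.
move=> a0 mf f0.
have mphi : measurable_fun (setT : set Rm) (fun x : Rm => (a * x + b)%R : Rm).
  by apply: measurable_funD => //; apply: measurable_funM.
pose pm := measure_function_pushforward__canonical__measure_function_Measure mu mphi.
have -> : (\int[mu]_x f x = \int[mscale (NngNum (normr_ge0 a)) pm]_x f x)%E.
  by apply: eq_measure_integral => A mA _;
      first [exact: (lebesgue_measure_affine b a0 mA)|apply: esym;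
      exact: (lebesgue_measure_affine b a0 mA)].
rewrite ge0_integral_mscale// muleA -EFinM mulVf ?normr_eq0// mul1e.
by rewrite (ge0_integral_pushforward mphi)//.
Qed.

Lemma Rintegral_affine (a b : R) (f : R -> R) : a != 0 -> integ f ->
  \int[mu]_x f (a * x + b) = `|a|^-1 * \int[mu]_x f x.
Proof.
move=> a0 fi; have mF := measurable_int mu fi.
rewrite /Rintegral -[X in X * _]/(fine (`|a|^-1)%:E) -fineM//;
    last exact: integrable_fin_num.
congr fine; rewrite integralE [in RHS]integralE muleBr//; last first.
  by apply: fin_num_adde_defr; apply: (integrable_fin_num measurableT);
      exact: integrable_funepos.
rewrite -!(ge0_integral_affine b)//;
    [|exact: measurable_funeneg|exact: measurable_funepos].
by congr (_ - _)%E; apply: eq_integral => x _;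
    rewrite ?(funepos_comp (EFin \o f) (fun x => a * x + b)) ?(funeneg_comp
    (EFin \o f) (fun x => a * x + b)).
Qed.

Lemma integ_affine (a b : R) (f : R -> R) : a != 0 -> integ f -> integ (fun x =>
    f (a * x + b)).
Proof.
move=> a0 fi; have mf := integ_measurable fi; apply/integrableP; split.
  apply/measurable_EFinP; apply: measurableT_comp => //.
  by apply: measurable_funD => //; apply: measurable_funM.
rewrite (ge0_integral_affine b (f := fun x => `|(f x)%:E|%E))//.
  move/integrableP : fi => [_ fi]; apply: lte_mul_pinfty => //.
by do 2 apply: measurableT_comp => //.
Qed.


Lemma Rintegral_if (a b : R) (f : R -> R) :
  \int[mu]_x (if a < x < b then f x else 0) = \int[mu]_(x in `]a, b[) f x.
Proof.
rewrite [RHS]Rintegral_mkcond; apply: eq_Rintegral => x _; rewrite patchE.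
by case: ifPn => h; [rewrite mem_set//= in_itv|rewrite memNset//= in_itv/=; exact/negP].
Qed.

Lemma is_derive_continuous (f F : R -> R) : (forall x, is_derive x (1 : R) F
    (f x)) -> continuous F.
Proof.
move=> dF x; apply: differentiable_continuous; apply/derivable1_diffP.
exact: (@ex_derive _ _ _ _ _ _ _ (dF x)).
Qed.

Lemma Rintegral_FTC (f F : R -> R) (a b : R) : a <= b -> continuous f ->
  (forall x, is_derive x (1 : R) F (f x)) ->
  \int[mu]_x (if a < x < b then f x else 0) = F b - F a.
Proof.
rewrite le_eqVlt => /predU1P[<- _ _|ab cf dF].
  rewrite Rintegral_if subrr set_itvoo0 ?Rintegral_set0//.
have cF : continuous F := is_derive_continuous dF.
have cfw : {within `[a, b], continuous f} by exact: continuous_subspaceT.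
rewrite Rintegral_if /Rintegral integral_itv_obnd_cbnd; last first.
  by apply/measurable_EFinP; apply: measurable_funTS; exact: continuous_measurable_fun.
rewrite integral_itv_bndo_bndc; last first.
  by apply/measurable_EFinP; apply: measurable_funTS; exact: continuous_measurable_fun.
rewrite (continuous_FTC2 ab cfw (F := F))//.
  split => [x _||].
  - exact: ex_derive.
  - exact/cvg_at_right_filter/cF.
  - exact/cvg_at_left_filter/cF.
by move=> x _; rewrite derive1E derive_val.
Qed.

Lemma integ_bounded (f : R -> R) (a b M : R) : measurable_fun (setT : set Rm) f ->
  (forall x, `|f x| <= M) -> (forall x, ~~ (a < x < b) -> f x = 0) -> integ f.
Proof.
move=> mf fM f0; apply: (integ_dom mf (integZl M (integ_itv a b))) => x.
case: ifPn => h; first by rewrite mulr1.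
by rewrite f0// normr0 mulr0.
Qed.

Lemma Rintegral_le (f g : R -> R) : integ f -> integ g -> (forall x, f x <= g x) ->
  \int[mu]_x f x <= \int[mu]_x g x.
Proof. by move=> fi gi fg; apply: le_Rintegral. Qed.

Lemma Rintegral_norm_le (f g : R -> R) : integ f -> integ g -> (forall x, `|f x|
    <= g x) ->
  `|\int[mu]_x f x| <= \int[mu]_x g x.
Proof.
move=> fi gi fg; apply: le_trans (le_normr_Rintegral measurableT fi) _.
by apply: Rintegral_le => //; exact: integ_norm.
Qed.

Lemma measurable_cos : measurable_fun (setT : set Rm) (@cos R).
Proof. by apply: continuous_measurable_fun; exact: continuous_cos. Qed.

Lemma measurable_sin : measurable_fun (setT : set Rm) (@sin R).
Proof. by apply: continuous_measurable_fun; exact: continuous_sin. Qed.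

End Toolbox.

(** Directed by the syntax of the function. The last clause also composes with measurability
    hypotheses from the context, and it leaves a goal open instead of failing. *)
Ltac meas_fun :=
  lazymatch goal with
  | |- measurable_fun _ (fun x => if _ then _ else _) =>
      apply: measurable_fun_ifT; meas_fun
  | |- measurable_fun _ (fun x => @Order.lt _ _ _ _) =>
      apply: measurable_fun_ltr; meas_fun
  | |- measurable_fun _ (fun x => @Order.le _ _ _ _) =>
      apply: measurable_fun_ler; meas_fun
  | |- measurable_fun _ (@Order.lt _ _ _) => apply: measurable_fun_ltr; meas_fun
  | |- measurable_fun _ (@Order.le _ _ _) => apply: measurable_fun_ler; meas_fun
  | |- measurable_fun _ ( *%R _) => apply: measurable_funM; meas_fun
  | |- measurable_fun _ ( +%R _) => apply: measurable_funD; meas_fun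
  | |- measurable_fun _ (fun x => _ && _) => apply: measurable_and; meas_fun
  | |- measurable_fun _ (fun x => _ - _) => apply: measurable_funB; meas_fun
  | |- measurable_fun _ (fun x => _ + _) => apply: measurable_funD; meas_fun
  | |- measurable_fun _ (fun x => - _) => apply: measurable_funN; meas_fun
  | |- measurable_fun _ (fun x => _ * _) => apply: measurable_funM; meas_fun
  | |- measurable_fun _ (fun x => _ ^+ _) => apply: measurable_funX; meas_fun
  | |- measurable_fun _ (fun x => `|_|) => apply: (measurableT_comp
      (@normr_measurable _ _)); meas_fun
  | |- measurable_fun _ (fun x => expR _) => apply: (measurableT_comp
      (@measurable_expR _)); meas_fun
  | |- measurable_fun _ (fun x => cos _) => apply: (measurableT_comp
      (@measurable_cos _)); meas_fun
  | |- measurable_fun _ (fun x => sin _) => apply: (measurableT_comp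
      (@measurable_sin _)); meas_fun
  | |- measurable_fun _ (fun x => (_, _)) => apply: measurable_fun_pair; meas_fun
  | |- measurable_fun _ (fun x => x) => exact: measurable_id
  | |- measurable_fun _ (fun x => x.1) => exact: measurable_fst
  | |- measurable_fun _ (fun x => x.2) => exact: measurable_snd
  | |- measurable_fun _ (fun x => fst _) =>
      apply: (measurableT_comp measurable_fst); meas_fun
  | |- measurable_fun _ (fun x => snd _) =>
      apply: (measurableT_comp measurable_snd); meas_fun
  | |- measurable_fun _ _ =>
    first [ assumption | exact: measurable_cst | exact: measurable_id
    | exact: measurable_fst | exact: measurable_snd
    | match goal with H : measurable_fun _ ?p |- measurable_fun _ (fun x => ?p (@?g x)) =>
        apply: (measurableT_comp H); meas_fun end
    | idtac ]
  end.

(** * Exponential weights and Gronwall's inequality *)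

Section Weight.
Context {R : realType}.
Local Notation mu := (@lebesgue_measure R).
Local Notation Rm := (measurableTypeR R).
Implicit Types (b x c lam M : R) (f g F G p q Q : R -> R).

Lemma is_derive_expRZ (c x : R) : is_derive x (1 : R) (fun s => expR (c * s))
    (c * expR (c * x)).
Proof.
have h : is_derive x (1:R) (fun s : R => c * s) c.
  by have := is_deriveZ c (is_derive_id x (1 : R)); rewrite /GRing.scale/= mulr1.
by have := @is_derive1_comp _ expR (fun s => c * s) x _ _ (is_derive_expR _) h;
    rewrite mulrC.
Qed.

Lemma Rintegral_expRZ (c u v : R) : c != 0 -> u <= v ->
  \int[mu]_s (if u < s < v then expR (c * s) else 0) = (expR (c * v) - expR (c * u)) / c.
Proof.
move=> c0 uv.
have dF x : is_derive x (1 : R) (fun s => c^-1 * expR (c * s)) (expR (c * x)).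
  by have := is_deriveZ c^-1 (is_derive_expRZ c x); rewrite /GRing.scale/= mulKf.
have cf : continuous (fun s => expR (c * s)).
  exact: is_derive_continuous (is_derive_expRZ c).
by rewrite (Rintegral_FTC uv cf dF) -mulrBr mulrC.
Qed.

Lemma integ_expRZ (c u v : R) : integ (fun s => if u < s < v then expR (c * s) else 0).
Proof.
apply: (@integ_bounded _ _ u v (expR (`|c| * (`|u| + `|v|)))).
- by meas_fun.
- move=> x; case: ifPn => [/andP[ux xv]|_]; last by rewrite normr0 expR_ge0.
  rewrite ger0_norm ?expR_ge0// ler_expR (le_trans (ler_norm _))// normrM ler_wpM2l//.
  have := ler_norm v; have := ler_normr (- u) (- u); rewrite normrN lexx => /= /esym.
  have := normr_ge0 u; have := normr_ge0 v => ? ? ? ?.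
  by rewrite ler_norml; apply/andP; split; lra.
- by move=> x /negbTE ->.
Qed.

(** Closes the arguments in which a contraction by 1/2 is iterated. *)
Lemma le_half_pow (x C : R) : (forall n, x <= C / 2 ^+ n) -> x <= 0.
Proof.
move=> h; rewrite leNgt; apply/negP => x0.
have [n Hn] : exists n : nat, C / x < n%:R.
  by exists (Num.truncn (C / x)).+1; exact: truncnS_gt.
have := h n; apply/negP; rewrite -ltNge ltr_pdivrMr ?exprn_gt0// mulrC -ltr_pdivrMr//.
by rewrite (lt_trans Hn)// -natrX ltr_nat ltn_expl.
Qed.

(** Vanishing off the interval is built in, so that all integrals run over the whole line and
    cut-offs become conditions in the integrand. *)
Definition L2_itv (b : R) (p : R -> R) : Prop :=
  [/\ measurable_fun (setT : set Rm) p, integ (fun x => p x ^+ 2) &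
      forall x : R, ~~ (0 < x < b) -> p x = 0].

Lemma L2_integ b p : L2_itv b p -> integ p.
Proof.
move=> [mp ip p0]; apply: (integ_dom mp (integD ip (integ_itv 0 b))) => x.
case: ifPn => h; last by rewrite p0// normr0 expr0n addr0.
by rewrite -real_normK ?num_real//; have := sqr_ge0 (`|p x| - 2^-1); nra.
Qed.

(** Young's inequality with a free parameter: a small [e] absorbs the norm of [p], and the large
    factor left on [w] is later beaten by a steep exponential weight. *)
Lemma L2_weight_aux b p (e : R) (D : R -> bool) (w : R -> R) : L2_itv b p -> 0 < e ->
  measurable_fun (setT : set Rm) D -> measurable_fun (setT : set Rm) w ->
      (forall s, 0 <= w s) ->
  integ (fun s => if D s && (0 < s < b) then w s ^+ 2 else 0) ->
  integ (fun s => if D s then `|p s| * w s else 0) /\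
  \int[mu]_s (if D s then `|p s| * w s else 0) <=
  e * (\int[mu]_s p s ^+ 2) + (4 * e)^-1 * \int[mu]_s
      (if D s && (0 < s < b) then w s ^+ 2 else 0).
Proof.
move=> [mp ip p0] e0 mD mw w0 iw.
have amgm (a v : R) : 0 <= v -> `|a| * v <= e * a ^+ 2 + (4 * e)^-1 * v ^+ 2.
  move=> v0; rewrite -(real_normK (num_real a)) -subr_ge0.
  have -> : e * `|a| ^+ 2 + (4 * e)^-1 * v ^+ 2 - `|a| * v = (2 * e * `|a|
      - v) ^+ 2 / (4 * e).
    by field; rewrite gt_eqF.
  by rewrite divr_ge0 ?sqr_ge0//; lra.
have e4 : 0 < (4 * e)^-1 by rewrite invr_gt0; lra.
have fg s : `|if D s then `|p s| * w s else 0| <= e * p s ^+ 2 + (4 * e)^-1 *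
    (if D s && (0 < s < b) then w s ^+ 2 else 0).
  case: (D s) => /=; last by rewrite normr0 mulr0 addr0 mulr_ge0 ?sqr_ge0// ltW.
  case: ifPn => h; first by rewrite ger0_norm ?mulr_ge0// amgm.
  by rewrite p0// normr0 mul0r normr0 mulr0 expr0n/= mulr0 addr0.
have gi : integ (fun s => e * p s ^+ 2 + (4 * e)^-1 *
    (if D s && (0 < s < b) then w s ^+ 2 else 0)).
  by apply: integD; exact: integZl.
have fi : integ (fun s => if D s then `|p s| * w s else 0)
    by apply: integ_dom gi fg; meas_fun.
split => //; rewrite -RintegralZl// -RintegralZl// -RintegralD//;
    [|exact: integZl|exact: integZl].
by apply: Rintegral_le => // s; exact: le_trans (ler_norm _) (fg s).
Qed.

Lemma Rintegral_expRZ_le (c u v : R) : c != 0 ->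
  \int[mu]_s (if u < s < v then expR (c * s) else 0) <=
      expR (c * (if 0 < c then v else u)) / `|c|.
Proof.
move=> c0; have [uv|vu] := leP u v; last first.
  rewrite (_ : (fun s => _) = fun=> 0).
    by rewrite Rintegral_cst// mul0r divr_ge0 ?expR_ge0.
  by apply/funext => s; case: ifPn => // /andP[h1 h2]; have := lt_trans h1 h2;
      rewrite ltNge (ltW vu).
rewrite Rintegral_expRZ//; case: ltP => hc.
  by rewrite gtr0_norm// ler_wpM2r ?invr_ge0 ?(ltW hc)// lerBlDr lerDl expR_ge0.
have hc' : c < 0 by rewrite lt_neqAle c0.
rewrite ltr0_norm// invrN -subr_ge0.
have -> : expR (c * u) * - c^-1 - (expR (c * v) - expR (c * u)) / c =
    expR (c * v) * (- c)^-1.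
  by field.
by rewrite mulr_ge0 ?expR_ge0// invr_ge0 oppr_ge0.
Qed.

(* Conjugating by the weight expR (c x) turns the Volterra operators with kernel
   p into contractions, which replaces factorial bounds on their iterates. *)
Lemma L2_weight b p : L2_itv b p -> exists2 c : R, 0 < c & forall x : R,
  (\int[mu]_s (if s < x then `|p s| * expR (c * s) else 0) <= expR (c * x) / 2) /\
  (\int[mu]_s (if x < s then `|p s| * expR (- c * s) else 0) <= expR (- c * x) / 2).
Proof.
move=> pL; have [mp ip p0] := pL; have pi := L2_integ pL.
set N := \int[mu]_x p x ^+ 2.
have N0 : 0 <= N by apply: Rintegral_ge0 => x _; exact: sqr_ge0.
(* Each of the two terms of [L2_weight_aux] then contributes at most 1/4. Using N + 1 keeps both
   constants positive when p = 0. *)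
pose e : R := (4 * (N + 1))^-1; pose c : R := 2 * (N + 1).
have e0 : 0 < e by rewrite invr_gt0; lra.
have c0 : 0 < c by rewrite /c; lra.
have eN : e * N <= 1 / 4.
  by rewrite /e mulrC ler_pdivrMr; lra.
have ce : (4 * e)^-1 * (2 * c)^-1 = 1 / 4.
  by rewrite /e /c; field; lra.
(* Both inequalities at once, with k = c or k = - c. On [D] the normalized weight exp (k (s - x))
   decays away from x, and its square has integral at most 1 / (2 c). *)
have key (D : R -> bool) (k x : R) : `|k| = c -> measurable_fun (setT : set Rm) D ->
    (forall s, 0 < s < b -> D s -> (if 0 < k then s < x else x < s)) ->
    \int[mu]_s (if D s then `|p s| * expR (k * s) else 0) <= expR (k * x) / 2.
  move=> kc mD Dx.
  have k0 : k != 0 by rewrite -normr_gt0 kc.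
  pose w s := expR (k * s) * expR (- (k * x)).
  have mw : measurable_fun (setT : set Rm) w.
    by rewrite /w; meas_fun.
  have w0 s : 0 <= w s by rewrite mulr_ge0 ?expR_ge0.
  have wE s : w s ^+ 2 = expR (- (2 * k * x)) * expR (2 * k * s).
    by rewrite exprMn -!expRM_natl mulrC; congr (expR _ * expR _); ring.
  pose u := if 0 < k then 0 else x; pose v := if 0 < k then x else b.
  have Duv s : `|if D s && (0 < s < b) then w s ^+ 2 else 0| <=
      expR (- (2 * k * x)) * (if u < s < v then expR (2 * k * s) else 0).
    case: ifPn => [/andP[Ds sb]|_].
      have -> : u < s < v.
        by move: (Dx s sb Ds); case/andP: sb; rewrite /u /v; case: ifP =>
            _ h1 h2 h3; apply/andP.
      by rewrite wE ger0_norm// mulr_ge0 ?expR_ge0.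
    by rewrite normr0 mulr_ge0 ?expR_ge0//; case: ifP => // _; exact: expR_ge0.
  have i1 := integZl (expR (- (2 * k * x))) (integ_expRZ (2 * k) u v).
  have i2 : integ (fun s => if D s && (0 < s < b) then w s ^+ 2 else 0).
    by apply: integ_dom i1 Duv; meas_fun.
  have [iw] := L2_weight_aux pL e0 mD mw w0 i2.
  have : \int[mu]_s (if D s && (0 < s < b) then w s ^+ 2 else 0) <= (2 * c)^-1.
    apply: le_trans (Rintegral_le i2 i1 (fun s => le_trans (ler_norm _) (Duv s))) _.
    rewrite RintegralZl//; last exact: integ_expRZ.
    have k2 : 2 * k != 0 by rewrite mulf_neq0.
    apply: (@le_trans _ _ (expR (- (2 * k * x)) * (expR (2 * k * x) / (2 * c)))).
      rewrite ler_wpM2l ?expR_ge0//; apply: le_trans (Rintegral_expRZ_le _ _ k2) _.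
      rewrite pmulr_rgt0// normrM kc ger0_norm//.
      have -> // : (if 0 < k then v else u) = x by rewrite /u /v; case: (0 < k).
    by rewrite mulrA -expRD addNr expR0 mul1r.
  rewrite -/N => h1 h2.
  have h3 : \int[mu]_s (if D s then `|p s| * w s else 0) <= 1 / 2.
    have := ler_wpM2l (_ : 0 <= (4 * e)^-1) h1; rewrite ce => /(_ _).
    by rewrite invr_ge0 => /(_ ltac:(lra)); lra.
  have -> : (fun s => if D s then `|p s| * expR (k * s) else 0) =
      (fun s => expR (k * x) * (if D s then `|p s| * w s else 0)).
    apply/funext => s; case: ifP => _; rewrite ?mulr0// /w [in RHS]mulrCA
        [_ * (_ * expR (- _))]mulrCA -expRD.
    by rewrite subrr expR0 mulr1.
  by rewrite RintegralZl// ler_wpM2l ?expR_ge0//; lra.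
exists c => // x; split.
  by apply: key; [rewrite gtr0_norm|meas_fun|rewrite c0].
by apply: key; [rewrite normrN gtr0_norm|meas_fun|rewrite oppr_gt0 ltNge (ltW c0)].
Qed.
End Weight.

Section AC.
Context {R : realType}.
Local Notation mu := (@lebesgue_measure R).
Local Notation Rm := (measurableTypeR R).
Implicit Types (b x c lam M : R) (f g F G p q Q : R -> R).

Lemma RintD f g : integ f -> integ g ->
  \int[mu]_x (f x + g x) = \int[mu]_x f x + \int[mu]_x g x.
Proof. exact: RintegralD. Qed.

Lemma RintB f g : integ f -> integ g ->
  \int[mu]_x (f x - g x) = \int[mu]_x f x - \int[mu]_x g x.
Proof. exact: RintegralB. Qed.

Lemma RintZ k f : integ f -> \int[mu]_x (k * f x) = k * \int[mu]_x f x.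
Proof. exact: RintegralZl. Qed.

Lemma ae_mono (P Q : R -> Prop) : {ae mu, forall x, P x} -> (forall x, P x -> Q x) ->
  {ae mu, forall x, Q x}.
Proof. by move=> Pae PQ; apply: negligibleS Pae => x /= nQ Px; exact/nQ/PQ. Qed.

Lemma Rint_ae (f g : Rm -> R) : measurable_fun (setT : set Rm) f ->
    measurable_fun (setT : set Rm) g ->
  {ae mu, forall x, f x = g x} -> \int[mu]_x f x = \int[mu]_x g x.
Proof.
move=> mf mg fg; congr fine; apply: ae_eq_integral => //;
    [exact/measurable_EFinP|exact/measurable_EFinP|].
by apply: (ae_mono fg) => x /= -> _.
Qed.

(** Measured against exp (- c x), the operator on the right halves bounds. Feeding the inequality
    into itself n times gives E x <= C exp (- c x) / 2 ^ n. *)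
Lemma gronwall_backward b (p E : R -> R) (M : R) : L2_itv b p -> measurable_fun
    (setT : set Rm) E ->
  (forall x, `|E x| <= M) ->
  (forall x : R, 0 <= x <= b -> E x <= \int[mu]_s (if x < s then `|p s| * E s else 0)) ->
  forall x : R, 0 <= x <= b -> E x <= 0.
Proof.
move=> pL mE EM hE.
have [c c0 hc] := L2_weight pL; have [mp _ p0] := pL; have pi := integ_norm (L2_integ pL).
have M0 : 0 <= M := le_trans (normr_ge0 _) (EM 0).
(* The factor exp (c b) makes the initial bound at least M on [0, b], where the weight is smallest
   at b. *)
pose C := M * expR (c * b).
suff key n x : 0 <= x <= b -> E x <= C * expR (- c * x) / 2 ^+ n.
  by move=> x hx; apply: (@le_half_pow _ _ (C * expR (- c * x))) => n; exact: key.
elim: n x => [x /andP[_ xb]|n IH x hx].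
  rewrite expr0 divr1 /C -mulrA -expRD (le_trans (ler_norm _))// (le_trans (EM x))//.
  rewrite ler_peMr// -expR0 ler_expR mulNr -mulrBr mulr_ge0 ?subr_ge0//; exact: ltW.
have [_ hcx] := hc x.
have iE : integ (fun s => if x < s then `|p s| * E s else 0).
  apply: (integ_dom _ (integZl M pi)) => [|s]; first by meas_fun.
  case: ifP => _; last by rewrite normr0 mulr_ge0.
  by rewrite normrM normr_id mulrC ler_wpM2r.
have iw : integ (fun s => if x < s then `|p s| * expR (- c * s) else 0).
  apply: (integ_dom _ (integZl (expR (- c * x)) pi)) => [|s]; first by meas_fun.
  case: ifP => xs; last by rewrite normr0 mulr_ge0 ?expR_ge0.
  rewrite normrM normr_id mulrC (ger0_norm (expR_ge0 _)) ler_wpM2r// ler_expR.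
  by rewrite !mulNr lerN2 ler_wpM2l// ltW.
apply: le_trans (hE x hx) _.
apply: (@le_trans _ _ (C / 2 ^+ n * \int[mu]_s (if x < s then `|p s|
    * expR (- c * s) else 0))).
  rewrite -RintegralZl//; apply: Rintegral_le => //; first exact: integZl.
  move=> s; case: ifP => xs; last by rewrite mulr0.
  have [sb|sb] := boolP (0 < s < b); last by rewrite p0// normr0 !mul0r mulr0.
  rewrite mulrCA ler_wpM2l// mulrAC; apply: IH.
  by case/andP: sb => /ltW -> /ltW ->.
have C0 : 0 <= C / 2 ^+ n by rewrite divr_ge0 ?mulr_ge0 ?expR_ge0// exprn_ge0.
apply: le_trans (ler_wpM2l C0 hcx) _.
by rewrite exprSr; rewrite le_eqVlt; apply/orP; left; apply/eqP; field; rewrite expf_neq0.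
Qed.

(** * Absolutely continuous functions and integration by parts *)

Definition restr (b : R) (f : R -> R) (t : R) : R := if 0 < t < b then f t else 0.

Lemma restr_integ b f : mu.-integrable `]0, b[ (EFin \o f) -> integ (restr b f).
Proof.
move=> fi; have := (integrable_mkcond (mu := mu) (EFin \o f)
    (measurable_itv `]0, b[)).1 fi.
apply: eq_integrable => // x _; rewrite /restr patchE /=.
have [h|h] := boolP (0 < x < b); first by rewrite mem_set//= in_itv.
by rewrite memNset//= in_itv/=; exact/negP.
Qed.

Lemma AC_integ b f F : AC_deriv b f F -> integ (restr b F).
Proof. by move=> [+ _]; exact: restr_integ. Qed.

Lemma AC_val b f F (x : R) : AC_deriv b f F -> 0 <= x <= b ->
  f x = f 0 + \int[mu]_s (if s < x then restr b F s else 0).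
Proof.
move=> [_ fF] hx; rewrite fF// -Rintegral_if; congr (_ + _); apply: eq_Rintegral => s _.
rewrite /restr; case/andP: hx => x0 xb; case: (ltP 0 s) => s0 /=; last by rewrite if_same.
by case: ltP => sx //; rewrite (lt_le_trans sx xb).
Qed.

(** With the closed end available, complementary conditions such as t < s and s <= t split a domain
    exactly, and the diagonal needs no separate treatment. *)
Lemma AC_val_le b f F (x : R) : AC_deriv b f F -> 0 <= x <= b ->
  f x = f 0 + \int[mu]_s (if s <= x then restr b F s else 0).
Proof.
move=> fF hx; rewrite (AC_val fF hx); congr (_ + _).
have Fi := AC_integ fF.
have E1 : \int[mu]_s (if s < x then restr b F s else 0) = \int[mu]_(s in `]-oo,
    x[) restr b F s.
  rewrite [RHS]Rintegral_mkcond; apply: eq_Rintegral => s _; rewrite patchE.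
  by case: ifPn => h; [rewrite mem_set//= in_itv|rewrite memNset//= in_itv/=; exact/negP].
have E2 : \int[mu]_s (if s <= x then restr b F s else 0) = \int[mu]_(s in `]-oo,
    x]) restr b F s.
  rewrite [RHS]Rintegral_mkcond; apply: eq_Rintegral => s _; rewrite patchE.
  by case: ifPn => h; [rewrite mem_set//= in_itv|rewrite memNset//= in_itv/=; exact/negP].
rewrite E1 E2; apply: Rintegral_itv_bndo_bndc; exact: (integrableS measurableT).
Qed.

Lemma AC_meas b f F : AC_deriv b f F -> measurable_fun (setT : set Rm) (restr b f).
Proof.
move=> fF; have mF := integ_measurable (AC_integ fF).
have -> : restr b f = (fun x => if 0 < x < b then f 0 + \int[mu]_s
    (if s < x then restr b F s else 0) else 0).
  apply/funext => x; rewrite /restr; case: ifPn => // /andP[x0 xb].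
  by rewrite (AC_val fF)// !ltW.
have m2 : measurable_fun (setT : set Rm) (fun x => \int[mu]_s
    (if s < x then restr b F s else 0)).
  apply: (@measurable_Rintegral _ _ _ (fun z : Rm * Rm =>
      if z.2 < z.1 then restr b F z.2 else 0)).
  by meas_fun.
by meas_fun.
Qed.

Lemma AC_bnd b f F : AC_deriv b f F -> exists2 M : R, 0 <= M & forall x : R,
    0 <= x <= b -> `|f x| <= M.
Proof.
move=> fF; have iF := AC_integ fF; have mF := integ_measurable iF.
exists (`|f 0| + \int[mu]_s `|restr b F s|).
  by rewrite addr_ge0// Rintegral_ge0.
move=> x hx; rewrite (AC_val fF hx) (le_trans (ler_normD _ _))// lerD2l.
apply: Rintegral_norm_le; [|exact: integ_norm|].
  by apply: (integ_dom _ (integ_norm iF)) => [|s]; [by meas_fun|case: ifP =>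
      // _; rewrite normr0].
by move=> s; case: ifP => // _; rewrite normr0.
Qed.

Lemma integ_bndM (f g : R -> R) (M : R) : integ f -> measurable_fun (setT : set Rm) g ->
  (forall x, `|g x| <= M) -> integ (fun x => f x * g x).
Proof.
move=> fi mg gM; have mf := integ_measurable fi.
apply: (integ_dom _ (integZl M (integ_norm fi))) => [|x]; first by meas_fun.
by rewrite normrM mulrC ler_wpM2r.
Qed.

Lemma restr_bnd b f (M : R) : 0 <= M -> (forall x : R, 0 <= x <= b -> `|f x| <=
    M) -> forall x, `|restr b f x| <= M.
Proof.
move=> M0 fM x; rewrite /restr; case: ifPn => [/andP[x0 xb]|_]; last by rewrite normr0.
by apply: fM; rewrite !ltW.
Qed.

Lemma integ_if (D : R -> bool) f : measurable_fun (setT : set Rm) D -> integ f ->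
  integ (fun s => if D s then f s else 0).
Proof.
move=> mD fi; have mf := integ_measurable fi.
by apply: (integ_dom _ (integ_norm fi)) => [|s]; [by meas_fun|case: ifP => // _;
    rewrite normr0].
Qed.

Lemma integ_Rintegral (f : Rm * Rm -> R) (a b : R -> R) :
  measurable_fun setT f -> integ a -> integ b ->
  (forall x y, `|f (x, y)| <= a x * b y) -> integ (fun x => \int[mu]_y f (x, y)).
Proof.
move=> mf ia ib fab; apply: (integ_dom _ (integZl (\int[mu]_y b y) ia)) => [|x].
  exact: measurable_Rintegral.
rewrite mulrC -RintegralZl//; apply: Rintegral_norm_le; [|exact: integZl|by []].
exact: integ_param fab.
Qed.

(** Integration by parts through Fubini: writing f and g as integrals of [F] and [G], the product of
    the two integrals is one over a square, cut into two triangles along the diagonal. *)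
Lemma AC_mul b f F g G (x : R) : AC_deriv b f F -> AC_deriv b g G -> 0 <= x <= b ->
  f x * g x - f 0 * g 0 =
  \int[mu]_s (if s < x then restr b F s * restr b g s else 0) +
  \int[mu]_s (if s < x then restr b G s * restr b f s else 0).
Proof.
move=> fF gG hx; have iF := AC_integ fF; have iG := AC_integ gG.
pose F' s := if s < x then restr b F s else 0; pose G' s :=
    if s < x then restr b G s else 0.
have iF' : integ F' by apply: integ_if => //; meas_fun.
have iG' : integ G' by apply: integ_if => //; meas_fun.
have mF' := integ_measurable iF'; have mG' := integ_measurable iG'.
have fE : f x = f 0 + \int[mu]_s F' s := AC_val fF hx.
have gE : g x = g 0 + \int[mu]_s G' s := AC_val gG hx.
have E1 : \int[mu]_s (if s < x then restr b F s * restr b g s else 0) =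
   \int[mu]_s (g 0 * F' s + \int[mu]_t (if t < s then F' s * G' t else 0)).
  apply: eq_Rintegral => s _; rewrite /F'; case: ifPn => sx; last first.
    rewrite mulr0 add0r (_ : (fun t => _) = fun=> 0) ?Rintegral_cst ?mul0r//.
    by apply/funext => t; rewrite mul0r if_same.
  rewrite /restr; case: ifPn => sb; last first.
    rewrite mul0r mulr0 add0r (_ : (fun t => _) = fun=> 0) ?Rintegral_cst ?mul0r//.
    by apply/funext => t; rewrite mul0r if_same.
  rewrite (AC_val gG); last by case/andP: sb => /ltW -> /ltW ->.
  rewrite mulrDr mulrC -RintegralZl//; last by apply: integ_if => //; meas_fun.
  congr (_ + _); apply: eq_Rintegral => t _; case: ifPn => ts; last by rewrite mulr0.
  by rewrite /G' (lt_trans ts sx).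
have E2 : \int[mu]_s (if s < x then restr b G s * restr b f s else 0) =
   \int[mu]_s (f 0 * G' s + \int[mu]_t (if t <= s then F' t * G' s else 0)).
  apply: eq_Rintegral => s _; rewrite /G'; case: ifPn => sx; last first.
    rewrite mulr0 add0r (_ : (fun t => _) = fun=> 0) ?Rintegral_cst ?mul0r//.
    by apply/funext => t; rewrite mulr0 if_same.
  rewrite /restr; case: ifPn => sb; last first.
    rewrite mul0r mulr0 add0r (_ : (fun t => _) = fun=> 0) ?Rintegral_cst ?mul0r//.
    by apply/funext => t; rewrite mulr0 if_same.
  rewrite (AC_val_le fF); last by case/andP: sb => /ltW -> /ltW ->.
  rewrite mulrDr mulrC -RintegralZl//; last by apply: integ_if => //; meas_fun.
  congr (_ + _); apply: eq_Rintegral => t _; case: ifPn => ts; last by rewrite mulr0.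
  by rewrite /F' (le_lt_trans ts sx) mulrC.
have m1 : measurable_fun (setT : set (Rm * Rm)%type) (fun z : Rm * Rm =>
    if z.2 < z.1 then F' z.1 * G' z.2 else 0).
  by meas_fun.
have m2 : measurable_fun (setT : set (Rm * Rm)%type) (fun z : Rm * Rm =>
    if z.1 <= z.2 then F' z.1 * G' z.2 else 0).
  by meas_fun.
have dom (B : bool) s t : `|if B then F' s * G' t else 0| <= `|F' s| * `|G' t|.
  by case: B; rewrite ?normrM// normr0 mulr_ge0.
have i1 : integ (fun s => \int[mu]_t (if t < s then F' s * G' t else 0)).
  apply: (integ_Rintegral m1 (integ_norm iF') (integ_norm iG')) => s t; exact: dom.
have m2' : measurable_fun (setT : set (Rm * Rm)%type) (fun z : Rm * Rm =>
    if z.2 <= z.1 then F' z.2 * G' z.1 else 0).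
  by meas_fun.
have i2 : integ (fun s => \int[mu]_t (if t <= s then F' t * G' s else 0)).
  apply: (integ_Rintegral m2' (integ_norm iG') (integ_norm iF')) => s t.
  by rewrite [leRHS]mulrC; exact: dom.
have i3 : integ (fun s => \int[mu]_t (if s <= t then F' s * G' t else 0)).
  apply: (integ_Rintegral m2 (integ_norm iF') (integ_norm iG')) => s t; exact: dom.
(* The two triangles tile the square; [E4] then exchanges the order of integration in the second one
   to match [E2]. *)
have E3 : \int[mu]_s \int[mu]_t (if t < s then F' s * G' t else 0) +
    \int[mu]_s \int[mu]_t (if s <= t then F' s * G' t else 0) =
    (\int[mu]_t G' t) * \int[mu]_s F' s.
  rewrite -(RintD i1 i3) -(RintZ _ iF'); apply: eq_Rintegral => s _.
  have j1 : integ (fun t => if t < s then F' s * G' t else 0)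
      by apply: integ_if; [meas_fun|exact: integZl].
  have j2 : integ (fun t => if s <= t then F' s * G' t else 0)
      by apply: integ_if; [meas_fun|exact: integZl].
  rewrite -(RintD j1 j2) mulrC -(RintZ _ iG'); apply: eq_Rintegral => t _.
  by case: ltP; rewrite ?addr0 ?add0r.
have E4 := @Rintegral_Fubini _ (fun z : Rm * Rm => if z.1 <=
    z.2 then F' z.1 * G' z.2 else 0) _ _ m2 (integ_norm iF') (integ_norm iG')
    (fun _ _ => dom _ _ _).
rewrite E1 E2 (RintD (integZl _ iF') i1) (RintD (integZl _ iG') i2)
    (RintZ _ iF') (RintZ _ iG').
by rewrite -E4 /= addrACA E3 fE gE; ring.
Qed.

End AC.

(** * Sturm-Liouville solutions *)

Section SL.
Context {R : realType}.
Local Notation mu := (@lebesgue_measure R).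
Local Notation Rm := (measurableTypeR R).
Implicit Types (b x c lam M : R) (f g F G p q Q : R -> R).

Lemma restr_integrable b (f : R -> R) : integ (restr b f) -> mu.-integrable `]0,
    b[ (EFin \o f).
Proof.
move=> fi; apply/(integrable_mkcond (mu := mu) (EFin \o f) (measurable_itv `]0, b[)).
apply: eq_integrable fi => // x _; rewrite /restr patchE /=.
have [h|h] := boolP (0 < x < b); first by rewrite mem_set//= in_itv.
by rewrite memNset//= in_itv/=; exact/negP.
Qed.

Lemma in_L2_L2_itv b q : in_L2 `]0, b[ q -> L2_itv b (restr b q).
Proof.
rewrite /in_L2.
have -> : q \_ (`]0, b[ : set R) = restr b q.
  apply/funext => x; rewrite /restr patchE.
  have [h|h] := boolP (0 < x < b); first by rewrite mem_set//= in_itv.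
  by rewrite memNset//= in_itv/=; exact/negP.
move=> qL; split; last by move=> x /negbTE; rewrite /restr => ->.
- by have := sub_Lfun_mfun qL; rewrite inE.
- exact: Lfun2_integrable_sqr.
Qed.

Lemma L2D b (f g : R -> R) : L2_itv b f -> L2_itv b g -> L2_itv b (fun x => f x + g x).
Proof.
move=> [mf fi f0] [mg gi g0]; split; first by meas_fun.
- apply: (integ_dom _ (integD (integZl 2 fi) (integZl 2 gi))) => [|x]; first by meas_fun.
  rewrite ger0_norm ?sqr_ge0//; have := sqr_ge0 (f x - g x); nra.
- by move=> x hx; rewrite f0// g0// addr0.
Qed.

Lemma L2_norm b f : L2_itv b f -> L2_itv b (fun x => `|f x|).
Proof.
move=> [mf fi f0]; split; first by meas_fun.
- by under eq_fun do rewrite real_normK ?num_real//.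
- by move=> x hx; rewrite f0// normr0.
Qed.

Lemma L2_cst b (c : R) : L2_itv b (restr b (fun=> c)).
Proof.
have m : measurable_fun (setT : set Rm) (restr b (fun=> c)) by rewrite /restr; meas_fun.
split => //; last by move=> x /negbTE; rewrite /restr => ->.
apply: (@integ_bounded _ _ 0 b (c ^+ 2)); first by meas_fun.
- by move=> x; rewrite /restr; case: ifP => _;
    rewrite ger0_norm ?sqr_ge0// expr0n sqr_ge0.
- by move=> x /negbTE; rewrite /restr => ->; rewrite expr0n.
Qed.

(* Q is already extended by 0 outside ]0, b[. *)
Definition SL_system (b : R) (Q : R -> R) (lam : R) (y y1 : R -> R) : Prop :=
  AC_deriv b y y1 /\ AC_deriv b y1 (fun s => (Q s - lam ^+ 2) * y s).

Lemma AC_restr_bnd b f F : AC_deriv b f F -> exists M : R, forall x, `|restr b f x| <= M.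
Proof. by move=> /AC_bnd[M M0 fM]; exists M; exact: restr_bnd. Qed.

Lemma SL_integ b Q lam y y1 : L2_itv b Q -> AC_deriv b y y1 ->
  integ (restr b (fun s => (Q s - lam ^+ 2) * y s)).
Proof.
move=> QL yA; have [M yM] := AC_restr_bnd yA; have my := AC_meas yA.
have iQ : integ (fun s => Q s - restr b (fun=> lam ^+ 2) s).
  by apply: integB; [exact: (L2_integ QL)|exact: (L2_integ (L2_cst _ _))].
have [_ _ Q0] := QL.
have -> : restr b (fun s => (Q s - lam ^+ 2) * y s) =
    (fun s => (Q s - restr b (fun=> lam ^+ 2) s) * restr b y s).
  by apply/funext => s; rewrite /restr; case: ifPn => h //; rewrite mulr0.
exact: integ_bndM yM.
Qed.

(** Lets the differential equation, which holds almost everywhere, replace the second derivative by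
    (Q - lam ^ 2) y. *)
Lemma AC_deriv_ae b f F G : AC_deriv b f F -> integ (restr b G) ->
  {ae mu, forall s, restr b F s = restr b G s} -> AC_deriv b f G.
Proof.
move=> fF iG FG; split; first exact: restr_integrable.
move=> x hx; have iF := AC_integ fF.
have mF := integ_measurable iF; have mG := integ_measurable iG.
have := AC_val fF hx => ->; congr (_ + _).
rewrite -Rintegral_if.
have -> : \int[mu]_x0 (if 0 < x0 < x then G x0 else 0) = \int[mu]_s
    (if s < x then restr b G s else 0).
  apply: eq_Rintegral => s _; rewrite /restr; case/andP: hx => x0 xb.
  case: (ltP 0 s) => s0 /=; last by rewrite if_same.
  by case: ltP => sx //; rewrite (lt_le_trans sx xb).
apply: Rint_ae; [by meas_fun|by meas_fun|].
by apply: (ae_mono FG) => s /= ->.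
Qed.

Lemma SL_solution_real b (q : R -> R) lam (y y1 : R -> R[i]) : L2_itv b (restr b q) ->
  SL_solution b q (lam ^+ 2)%:C%C y y1 ->
  SL_system b (restr b q) lam (@complex.Re R \o y) (@complex.Re R \o y1) /\
  SL_system b (restr b q) lam (@complex.Im R \o y) (@complex.Im R \o y1).
Proof.
move=> qL [y2 [[ryA iyA] [ry1A iy1A] eq]]; split; split => //.
- apply: (AC_deriv_ae ry1A); first exact: SL_integ ryA.
  apply: (ae_mono eq) => s /= h; rewrite /restr; case: ifPn => // hs.
  have := h; rewrite in_itv/= => /(_ hs); case: (y s) (y2 s) => [a b'] [a2 b2] /=.
  by rewrite -!complexr0 /= => -[]; simpc => /=; lra.
- apply: (AC_deriv_ae iy1A); first exact: SL_integ iyA.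
  apply: (ae_mono eq) => s /= h; rewrite /restr; case: ifPn => // hs.
  have := h; rewrite in_itv/= => /(_ hs); case: (y s) (y2 s) => [a b'] [a2 b2] /=.
  by rewrite -!complexr0 /= => -[]; simpc => /=; lra.
Qed.

Lemma AC_mul_integ b f F g G x : AC_deriv b f F -> AC_deriv b g G ->
  integ (fun s => if s < x then restr b F s * restr b g s else 0).
Proof.
move=> fF gG; have [M gM] := AC_restr_bnd gG; apply: integ_if; first by meas_fun.
exact: (integ_bndM (AC_integ fF) (AC_meas gG) gM).
Qed.

Lemma C1_AC b (f F : R -> R) : 0 <= b -> continuous f ->
  (forall x, is_derive x (1 : R) F (f x)) -> AC_deriv b F f.
Proof.
move=> b0 cf dF; split.
  have : mu.-integrable `[0, b] (EFin \o f).
    apply: continuous_compact_integrable; first exact: segment_compact.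
    exact: continuous_subspaceT.
  by apply: integrableS => //; exact: subset_itv_oo_cc.
move=> x /andP[x0 _]; rewrite -Rintegral_if (Rintegral_FTC x0 cf dF).
by rewrite addrC subrK.
Qed.

End SL.

(** * Variation of constants, Wronskians and backward uniqueness *)

Section Duhamel.
Context {R : realType}.
Local Notation mu := (@lebesgue_measure R).
Local Notation Rm := (measurableTypeR R).
Implicit Types (b x c lam M : R) (f g F G p q Q : R -> R).

(* The causal Green function of y'' + lam ^ 2 y. *)
Definition sigma lam x : R := if 0 < x then sin (lam * x) / lam else 0.

Lemma is_derive_lin lam (a x : R) : is_derive x (1 : R) (fun s : R =>
    lam * (a - s)) (- lam).
Proof.
have h1 : is_derive x (1 : R) (fun s : R => a - s) (- 1).
  by have := is_deriveB (is_derive_cst a x (1 : R)) (is_derive_id x (1 : R));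
      rewrite sub0r.
by have := is_deriveZ lam h1; rewrite /GRing.scale/= mulrN1.
Qed.

Lemma is_derive_cos_lin lam a x :
  is_derive x (1 : R) (fun s => cos (lam * (a - s))) (lam * sin (lam * (a - x))).
Proof.
have := @is_derive1_comp _ cos (fun s => lam * (a - s)) x _ _ (is_derive_cos _)
    (is_derive_lin lam a x).
by rewrite mulrNN mulrC.
Qed.

Lemma is_derive_sin_lin lam a x : lam != 0 ->
  is_derive x (1 : R) (fun s => lam^-1 * sin (lam * (a - s))) (- cos (lam * (a - x))).
Proof.
move=> l0.
have h := @is_derive1_comp _ sin (fun s => lam * (a - s)) x _ _
    (is_derive_sin _) (is_derive_lin lam a x).
have := is_deriveZ lam^-1 h; rewrite /GRing.scale/= mulrN mulrN mulrCA mulVf// mulr1.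
done.
Qed.

(** With g(s) = sin (lam (x - s)) / lam and c(s) = cos (lam (x - s)), the function y' g + y c has
    derivative Q y g: the terms in lam ^ 2 and those in y' cancel. Its values at s = x and s = 0 are
    y x and the free solution. *)
Lemma duhamel b Q lam (y y1 : R -> R) x : 0 < lam -> L2_itv b Q ->
    SL_system b Q lam y y1 -> 0 <= x <= b ->
  y x = y 0 * cos (lam * x) + y1 0 * sigma lam x + \int[mu]_s
      (sigma lam (x - s) * (Q s * y s)).
Proof.
move=> l0 QL [yA y1A] hx; have ln0 : lam != 0 by rewrite gt_eqF.
have b0 : 0 <= b by case/andP: hx; exact: le_trans.
pose c (s : R) := cos (lam * (x - s)); pose g (s : R) := lam^-1 * sin (lam * (x - s)).
have cc : continuous c by exact: (is_derive_continuous (is_derive_cos_lin lam x)).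
have cg : continuous g by exact: (is_derive_continuous (fun s =>
    is_derive_sin_lin x s ln0)).
have gA : AC_deriv b g (fun s => - c s).
  by apply: C1_AC => // [s|s]; [by apply: continuousN;
      exact: cc|exact: is_derive_sin_lin].
have cA : AC_deriv b c (fun s => lam ^+ 2 * g s).
  apply: C1_AC => // [s|s]; first
      by apply: (@continuousM _ _ (fun=> lam ^+ 2) g);
      [exact: cst_continuous|exact: cg].
  have -> : lam ^+ 2 * g s = lam * sin (lam * (x - s)) by rewrite /g; field.
  exact: is_derive_cos_lin.
have E1 := AC_mul y1A gA hx; have E2 := AC_mul yA cA hx.
have i1 := AC_mul_integ x y1A gA; have i2 := AC_mul_integ x gA y1A.
have i3 := AC_mul_integ x yA cA; have i4 := AC_mul_integ x cA yA.
have gx : g x = 0 by rewrite /g subrr mulr0 sin0 mulr0.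
have cx : c x = 1 by rewrite /c subrr mulr0 cos0.
have c0 : c 0 = cos (lam * x) by rewrite /c subr0.
have g0 : g 0 = sigma lam x.
  rewrite /g /sigma subr0; case: ifPn => [_|]; first by rewrite mulrC.
  rewrite -leNgt => x0; have -> : x = 0 by apply/eqP; rewrite eq_le x0; case/andP: hx.
  by rewrite mulr0 sin0 mulr0.
have [_ _ Q0] := QL.
have -> : \int[mu]_s (sigma lam (x - s) * (Q s * y s)) =
  \int[mu]_s ((if s < x then restr b (fun s => (Q s - lam ^+ 2) * y s) s * restr
      b g s else 0) +
    (if s < x then restr b (fun s => - c s) s * restr b y1 s else 0) +
   ((if s < x then restr b y1 s * restr b c s else 0) +
    (if s < x then restr b (fun s => lam ^+ 2 * g s) s * restr b y s else 0))).
  apply: eq_Rintegral => s _; rewrite /sigma subr_gt0; case: ifPn => sx; last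
      by rewrite mul0r !addr0.
  rewrite /restr; case: ifPn => sb; last by rewrite Q0// !mul0r mulr0 !addr0.
  by rewrite /g; field.
rewrite RintD; [|exact: integD|exact: integD].
rewrite (RintD i1 i2) (RintD i3 i4) -E1 -E2 gx cx c0 g0; ring.
Qed.

(** Lagrange's identity: for equal spectral parameters the terms in lam ^ 2 cancel in the derivative
    of y z' - y' z. *)
Lemma wronskian b Q Q' lam (y y1 z z1 : R -> R) : 0 <= b -> L2_itv b Q -> L2_itv b Q' ->
  SL_system b Q lam y y1 -> SL_system b Q' lam z z1 ->
  y b * z1 b - y1 b * z b = y 0 * z1 0 - y1 0 * z 0 + \int[mu]_s ((Q' s - Q s) *
      (y s * z s)).
Proof.
move=> b0 QL Q'L [yA y1A] [zA z1A].
have hb : 0 <= b <= b by rewrite b0 lexx.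
have E1 := AC_mul yA z1A hb; have E2 := AC_mul y1A zA hb.
have i1 := AC_mul_integ b yA z1A; have i2 := AC_mul_integ b z1A yA.
have i3 := AC_mul_integ b y1A zA; have i4 := AC_mul_integ b zA y1A.
have [_ _ Q0] := QL; have [_ _ Q'0] := Q'L.
have -> : \int[mu]_s ((Q' s - Q s) * (y s * z s)) =
  \int[mu]_s (((if s < b then restr b y1 s * restr b z1 s else 0) +
    (if s < b then restr b (fun s => (Q' s - lam ^+ 2) * z s) s * restr b y s else 0)) -
   ((if s < b then restr b (fun s => (Q s - lam ^+ 2) * y s) s * restr b z s else 0) +
    (if s < b then restr b z1 s * restr b y1 s else 0))).
  apply: eq_Rintegral => s _; case: ifPn => sb; last first.
    by rewrite Q0 ?Q'0 ?(negbTE sb) ?andbF// !addr0 subrr mul0r.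
  rewrite /restr; case: ifPn => sb'; last by rewrite Q0// Q'0// !mul0r !addr0 subrr mul0r.
  ring.
rewrite RintB; [|exact: integD|exact: integD].
rewrite (RintD i1 i2) (RintD i3 i4) -E1 -E2; ring.
Qed.

(** Let p = 1 + lam ^ 2 + |Q|, which dominates the coefficients of the first-order system, and let E
    x be the integral of p (|y| + |y'|) beyond x. Zero data at b bound each of |y| and |y'| by E, so
    E satisfies the Gronwall inequality with coefficient 2 p. *)
Lemma SL_system_backward b Q lam (y y1 : R -> R) : 0 <= b -> L2_itv b Q ->
    SL_system b Q lam y y1 ->
  y b = 0 -> y1 b = 0 -> forall x, 0 <= x <= b -> y x = 0.
Proof.
move=> b0 QL [yA y1A] yb y1b.
have [_ _ Q0] := QL; have [mQ _ _] := QL.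
have [M yM] := AC_restr_bnd yA; have [M1 y1M] := AC_restr_bnd y1A.
have my := AC_meas yA; have my1 := AC_meas y1A.
pose p s := restr b (fun=> 1 + lam ^+ 2) s + `|Q s|.
have pL : L2_itv b p by apply: L2D; [exact: L2_cst|exact: L2_norm].
have [mp _ p0] := pL; have ip := L2_integ pL.
have pge0 s : 0 <= p s.
  by rewrite /p addr_ge0// /restr; case: ifP => // _; rewrite addr_ge0 ?sqr_ge0.
pose e s := `|restr b y s| + `|restr b y1 s|.
have me : measurable_fun (setT : set Rm) e by rewrite /e; meas_fun.
have eM s : `|e s| <= M + M1.
  by rewrite ger0_norm ?addr_ge0// lerD.
pose E x := \int[mu]_s (if x < s then p s * e s else 0).
have ipe : integ (fun s => p s * e s) by exact: (integ_bndM ip me eM).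
have mpe := integ_measurable ipe.
have ie x : integ (fun s => if x < s then p s * e s else 0)
    by apply: integ_if => //; meas_fun.
have mE : measurable_fun (setT : set Rm) E.
  apply: (@measurable_Rintegral _ _ _ (fun z : Rm * Rm =>
      if z.1 < z.2 then p z.2 * e z.2 else 0)).
  by meas_fun.
have pe0 s : 0 <= p s * e s by rewrite mulr_ge0// addr_ge0.
have tail f F x : AC_deriv b f F -> f b = 0 -> 0 <= x <= b ->
    f x = - \int[mu]_s (if x < s then restr b F s else 0).
  move=> fA fb hx; have iF := AC_integ fA.
  have hb : 0 <= b <= b by rewrite b0 lexx.
  have := AC_val_le fA hb; rewrite fb (AC_val_le fA hx).
  have -> : \int[mu]_s (if s <= b then restr b F s else 0) =
     \int[mu]_s ((if s <= x then restr b F s else 0) + (if x < s then restr b F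
         s else 0)).
    apply: eq_Rintegral => s _; case: (leP s x) => sx.
      by rewrite (le_trans sx) ?addr0//; case/andP: hx.
    rewrite add0r; case: leP => // sb; rewrite /restr; case: ifPn => // /andP[_ h].
    by have := lt_trans sb h; rewrite ltxx.
  rewrite RintD; [lra|by apply: integ_if => //; meas_fun|by apply: integ_if =>
      //; meas_fun].
have Ef f F x : AC_deriv b f F -> f b = 0 -> 0 <= x <= b ->
    (forall s, `|restr b F s| <= p s * e s) ->
    `|f x| <= E x.
  move=> fA fb hx Fpe; rewrite (tail _ _ _ fA fb hx) normrN; have iF := AC_integ fA.
  apply: Rintegral_norm_le => //; first by apply: integ_if => //; meas_fun.
  by move=> s; case: ifP => // _; rewrite normr0.
have b1 s : `|restr b y1 s| <= p s * e s.
  rewrite /p /e /restr; case: ifP => _; last by rewrite normr0 addr0 mulr_ge0// addr_ge0.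
  have := normr_ge0 (y s); have := normr_ge0 (y1 s); have := normr_ge0 (Q s);
      have := sqr_ge0 lam; nra.
have b2 s : `|restr b (fun s => (Q s - lam ^+ 2) * y s) s| <= p s * e s.
  rewrite /p /e /restr; case: ifP => _; last by rewrite normr0 addr0 mulr_ge0// addr_ge0.
  rewrite normrM; apply: (@le_trans _ _ ((1 + lam ^+ 2 + `|Q s|) * `|y s|)).
    rewrite ler_wpM2r// (le_trans (ler_normB _ _))// [X in _ + X]ger0_norm
        ?sqr_ge0//; lra.
  by rewrite ler_wpM2l ?lerDl// addr_ge0// addr_ge0 ?sqr_ge0.
have eE x : 0 <= x <= b -> `|y x| + `|y1 x| <= E x + E x.
  by move=> hx; apply: lerD; [exact: Ef yA yb hx b1|exact: Ef y1A y1b hx b2].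
have E_ge0 x : 0 <= E x by apply: Rintegral_ge0 => s _; case: ifP.
have EM x : `|E x| <= \int[mu]_s (p s * e s).
  apply: Rintegral_norm_le => // s; case: ifP => _; rewrite ?normr0//.
  by rewrite ger0_norm.
have p2L : L2_itv b (fun s => p s + p s) by exact: L2D.
have gr x : 0 <= x <= b -> E x <= \int[mu]_s (if x < s then `|p s + p s| * E s else 0).
  move=> hx; apply: Rintegral_le => //.
    apply: integ_if; first by meas_fun.
    by apply: (integ_bndM _ mE EM); apply: integ_norm; exact: L2_integ p2L.
  move=> s; case: ifP => // _; have [sb|sb] := boolP (0 < s < b); last
      by rewrite p0// addr0 normr0 !mul0r.
  have hs : 0 <= s <= b by case/andP: sb => /ltW -> /ltW ->.
  have h : e s <= E s + E s by have := eE s hs; rewrite /e /restr sb.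
  have pp : `|p s + p s| = p s + p s by apply: ger0_norm; rewrite addr_ge0.
  by rewrite pp; have := ler_wpM2l (pge0 s) h; lra.
move=> x hx; have E0 := gronwall_backward p2L mE EM gr hx.
by apply/eqP; rewrite -normr_le0; have := eE x hx; have := normr_ge0 (y1 x); lra.
Qed.

End Duhamel.

(** * Kernels supported in the light cone *)

Section Kernel.
Context {R : realType}.
Local Notation mu := (@lebesgue_measure R).
Local Notation Rm := (measurableTypeR R).
Implicit Types (b x c lam M : R) (f g F G p q Q : R -> R).

Lemma measurable_cosZ lam : measurable_fun (setT : set Rm) (fun u : R => cos (lam * u)).
Proof.
apply: (measurableT_comp (f := @cos R) (g := fun u : R => lam * u));
    last exact: measurable_funM.
apply: continuous_measurable_fun; exact: continuous_cos.
Qed.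

Lemma measurable_sinZ lam : measurable_fun (setT : set Rm) (fun u : R => sin (lam * u)).
Proof.
apply: (measurableT_comp (f := @sin R) (g := fun u : R => lam * u));
    last exact: measurable_funM.
apply: continuous_measurable_fun; exact: continuous_sin.
Qed.

Lemma measurable_sigma lam : measurable_fun (setT : set Rm) (sigma lam).
Proof. by apply: measurable_fun_ifT; [meas_fun|apply: measurable_funM => //;
    exact: measurable_sinZ|]. Qed.

Lemma is_derive_sinZ lam x : lam != 0 ->
  is_derive x (1 : R) (fun s => lam^-1 * sin (lam * s)) (cos (lam * x)).
Proof.
move=> l0.
have h0 : is_derive x (1 : R) (fun s : R => lam * s) lam.
  by have := is_deriveZ lam (is_derive_id x (1 : R)); rewrite /GRing.scale/= mulr1.
have h := @is_derive1_comp _ sin (fun s => lam * s) x _ _ (is_derive_sin _) h0.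
by have := is_deriveZ lam^-1 h; rewrite /GRing.scale/= mulrCA mulVf// mulr1.
Qed.

(** For a <= 0 both sides vanish, the ball being empty and [sigma] being cut off, so that causality
    needs no case split in later uses. *)
Lemma Rintegral_ball_cos lam t a : lam != 0 ->
  \int[mu]_u (if `|t - u| < a then cos (lam * u) else 0) =
      2 * cos (lam * t) * sigma lam a.
Proof.
move=> l0; rewrite /sigma; case: ifPn => a0; last first.
  rewrite mulr0 (_ : (fun u => _) = fun=> 0) ?Rintegral_cst ?mul0r//.
  apply/funext => u; case: ifPn => // h; case/negP: a0; exact: le_lt_trans h.
under eq_Rintegral do rewrite ltr_distlC.
have cc : continuous (fun u => cos (lam * u)).
  move=> u; apply: (@continuous_comp _ _ _ (fun u => lam * u) cos);
      last exact: continuous_cos.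
  by apply: (@continuousM _ _ (fun=> lam) id); [exact: cst_continuous|].
have le : t - a <= t + a by lra.
rewrite (Rintegral_FTC le cc (fun x => is_derive_sinZ x l0)).
by rewrite mulrDr mulrBr sinD sinB; field.
Qed.

(** A bound uniform in [lam]: the case t = 0 of [Rintegral_ball_cos] shows 2 sigma as the integral
    of a cosine over an interval of length 2 a. *)
Lemma sigma_le lam (a : R) : lam != 0 -> 0 <= a -> `|sigma lam a| <= a.
Proof.
move=> l0 a0; have := Rintegral_ball_cos 0 a l0; rewrite mulr0 cos0 mulr1.
have -> : (fun u => if `|0 - u| < a then cos (lam * u) else 0) =
   (fun u => if - a < u < a then cos (lam * u) else 0).
  by apply/funext => u; rewrite distrC subr0 ltr_norml.
move=> E; have : `|\int[mu]_u (if - a < u < a then cos (lam * u) else 0)| <=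
    \int[mu]_u (if - a < u < a then 1 else 0).
  apply: Rintegral_norm_le; last 1 first.
  - by move=> u; case: ifP => _; rewrite ?normr0// cos_max.
  - apply: (integ_dom _ (integ_itv (- a) a)) => [|u].
      by meas_fun.
    by case: ifP => _; rewrite ?normr0// cos_max.
  - exact: integ_itv.
have an : - a <= a by lra.
have -> : \int[mu]_u (if - a < u < a then 1 else 0) = 2 * a.
  have := Rintegral_FTC an (@cst_continuous R R 1) (fun x => is_derive_id x
      (1 : R)) => ->.
  lra.
by rewrite E normrM ger0_norm//; lra.
Qed.

Lemma geo_cvg (u : nat -> R) (C : R) : (forall n, `|u n.+1 - u n| <= C / 2 ^+ n) ->
  u @ \oo --> limn u /\ forall n, `|limn u - u n| <= 2 * C / 2 ^+ n.
Proof.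
move=> h.
(* The subtracted term is the exact remainder of the geometric series; it makes the induction on k
   close. *)
have hk n k : `|u (n + k)%N - u n| <= 2 * C / 2 ^+ n - 2 * C / 2 ^+ (n + k).
  elim: k => [|k IH]; first by rewrite addn0 !subrr normr0.
  rewrite addnS; have := h (n + k)%N.
  have -> : u (n + k).+1 - u n = (u (n + k).+1 - u (n + k)%N) +
      (u (n + k)%N - u n) by ring.
  have -> : 2 * C / 2 ^+ (n + k).+1 = C / 2 ^+ (n + k) by rewrite exprS; field;
      rewrite expf_neq0.
  have := ler_normD (u (n + k).+1 - u (n + k)%N) (u (n + k)%N - u n).
  lra.
have C0 : 0 <= C by have := h 0%N; rewrite expr0 divr1; apply: le_trans.
have cu : cvgn u.
  have -> : u = (fun n => u 0%N + series (fun n => u n.+1 - u n) n).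
    by apply/funext => n; rewrite /series /= telescope_sumr// addrC subrK.
  apply: is_cvgD; first exact: is_cvg_cst.
  apply: normed_cvg; apply: (@series_le_cvg _ _ (geometric C 2^-1)) => //.
  - by move=> n /=.
  - by move=> n /=; rewrite mulr_ge0// exprn_ge0.
  - by move=> n /=; rewrite exprVn; exact: h.
  - by apply: is_cvg_geometric_series; rewrite ger0_norm ?invf_lt1 ?ltr1n.
split=> // n.
have cn : (fun m => `|u m - u n|) @ \oo --> `|limn u - u n|.
  by apply: cvg_norm; apply: cvgB => //; exact: cvg_cst.
have <- := cvg_lim (@norm_hausdorff _ _) cn.
apply: limr_le; first by apply/cvg_ex; eexists; exact: cn.
near=> m.
have nm : (n <= m)%N by near: m; exact: nbhs_infty_ge.
rewrite -(subnKC nm); apply: le_trans (hk _ _) _.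
by rewrite gerBl divr_ge0 ?mulr_ge0// exprn_ge0.
Unshelve. all: by end_near.
Qed.

(** The support condition is finite propagation speed, and it makes every row with x <= 0 vanish.
    The bound carries the exponential weight in which [kernJ] is a contraction. *)
Record kern (c M : R) (k : Rm * Rm -> R) : Prop := Kern {
  kern_meas : measurable_fun setT k ;
  kern_le : forall x u, `|k (x, u)| <= M * expR (c * x) ;
  kern_supp : forall x u : R, x <= `|u| -> k (x, u) = 0 }.

(* kern0 and kernJ represent the Volterra operator of the integral equation on
   cosine transforms, because
   sigma lam (x - s) * cos (lam * t) is half the integral of cos (lam * u) over
   the base |t - u| < x - s of a light cone. *)
Definition kern0 (Q : R -> R) (h : R) (z : Rm * Rm) : R :=
  2^-1 * ((if `|z.2| < z.1 then h else 0) +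
     \int[mu]_s (if `|s - z.2| < z.1 - s then Q s else 0)).

Definition kernJ (Q : R -> R) (k : Rm * Rm -> R) (z : Rm * Rm) : R :=
  2^-1 * \int[mu]_s (Q s * \int[mu]_t (if `|t - z.2| < z.1 - s then k (s, t) else 0)).

Lemma measurable_kern0 Q h : measurable_fun (setT : set Rm) Q ->
    measurable_fun setT (kern0 Q h).
Proof.
move=> mQ; apply: measurable_funM => //; apply: measurable_funD; first by meas_fun.
apply: (@measurable_Rintegral _ _ _ (fun w : (Rm * Rm) * Rm => if `|w.2 - w.1.2|
    < w.1.1 - w.2 then Q w.2 else 0)).
by meas_fun.
Qed.

Lemma measurable_kernJ Q k : measurable_fun (setT : set Rm) Q -> measurable_fun setT k ->
  measurable_fun setT (kernJ Q k).
Proof.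
move=> mQ mk; apply: measurable_funM => //.
apply: (@measurable_Rintegral _ _ _ (fun w : (Rm * Rm) * Rm =>
    Q w.2 * \int[mu]_t (if `|t - w.1.2| < w.1.1 - w.2 then k (w.2, t) else 0))).
apply: measurable_funM; first by meas_fun.
apply: (@measurable_Rintegral _ _ _ (fun v : ((Rm * Rm) * Rm) * Rm =>
    if `|v.2 - v.1.1.2| < v.1.1.1 - v.1.2 then k (v.1.2, v.2) else 0)).
by meas_fun.
Qed.


Lemma kern_le_const b c M k s t : 0 <= c -> 0 <= M -> kern c M k -> s <= b ->
    `|k (s, t)| <= M * expR (c * b).
Proof.
move=> c0 M0 [_ kM _] sb; apply: le_trans (kM s t) _.
by rewrite ler_wpM2l// ler_expR ler_wpM2l.
Qed.

Lemma kern_integ c M k (D : R -> bool) s : kern c M k -> measurable_fun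
    (setT : set Rm) D ->
  integ (fun t => if D t then k (s, t) else 0).
Proof.
move=> [mk kM ks] mD; apply: (@integ_bounded _ _ (- s) s (M * expR (c * s))).
- by meas_fun.
- move=> t; case: ifP => _; [exact: kM|rewrite normr0;
    exact: le_trans (normr_ge0 _) (kM s t)].
- by move=> t; rewrite -ltr_norml -leNgt => h; rewrite ks// if_same.
Qed.

Lemma kern_Rintegral_le c M k (D : R -> bool) s : 0 <= s -> kern c M k ->
    measurable_fun (setT : set Rm) D ->
  `|\int[mu]_t (if D t then k (s, t) else 0)| <= 2 * s * (M * expR (c * s)).
Proof.
move=> s0 kk mD; have [mk kM ks] := kk.
have an : - s <= s by lra.
have -> : 2 * s * (M * expR (c * s)) = \int[mu]_t (M * expR (c * s) *
    (if - s < t < s then 1 else 0)).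
  rewrite RintZ; last exact: integ_itv.
  have -> := Rintegral_FTC an (@cst_continuous R R 1) (fun x => is_derive_id x (1 : R)).
  ring.
apply: Rintegral_norm_le; [exact: kern_integ kk mD|by apply: integZl; exact: integ_itv|].
move=> t; case: (boolP (- s < t < s)) => h.
  rewrite mulr1; case: ifP => _; [exact: kM|rewrite normr0;
      exact: le_trans (normr_ge0 _) (kM s t)].
by rewrite ks ?if_same ?normr0 ?mulr0// leNgt ltr_norml.
Qed.

(** The inner integral runs over |t| < s, of length at most 2 b; with the factor 1/2 of [kernJ] this
    leaves b, which is why the weight is chosen for b Q. The support persists because |t - u| < x -
    s and |t| < s give |u| < x. *)
Lemma kernJ_kern b Q c M k : 0 < b -> 0 <= M -> L2_itv b Q ->
  (forall x, \int[mu]_s (if s < x then `|b * Q s| * expR (c * s) else 0) <=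
      expR (c * x) / 2) ->
  kern c M k -> kern c (M / 2) (kernJ Q k).
Proof.
move=> b0 M0 QL hc kk; have [mk kM ks] := kk; have [mQ _ Q0] := QL;
    have iQ := L2_integ QL.
split; first exact: measurable_kernJ.
- move=> x u; rewrite /kernJ /= normrM ger0_norm ?invr_ge0//.
  have iw : integ (fun s => if s < x then `|b * Q s| * expR (c * s) else 0).
    apply: (integ_dom _ (integZl (b * expR (`|c| * b)) (integ_norm iQ))) => [|s].
      by meas_fun.
    case: ifP => _; last by rewrite normr0 mulr_ge0// mulr_ge0 ?expR_ge0// ltW.
    have [sb|sb] := boolP (0 < s < b); last by rewrite Q0// mulr0 normr0 mul0r
        normr0 mulr0.
    rewrite normrM normr_id normrM (gtr0_norm b0) -mulrA -[leRHS]mulrA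
        (ler_pM2l b0) [leRHS]mulrC ler_wpM2l//.
    rewrite ger0_norm ?expR_ge0// ler_expR (le_trans (ler_norm _))// normrM ler_wpM2l//.
    by case/andP: sb => s0 sb; rewrite gtr0_norm// ltW.
  have le s : `|Q s * \int[mu]_t (if `|t - u| < x - s then k (s, t) else 0)| <=
      2 * M * (if s < x then `|b * Q s| * expR (c * s) else 0).
    case: ltP => sx; last first.
      rewrite mulr0 (_ : (fun t => _) = fun=> 0) ?Rintegral_cst ?mul0r ?mulr0 ?normr0//.
      apply/funext => t; case: ifPn => // h; have := le_lt_trans (normr_ge0 _) h.
      by rewrite subr_gt0 ltNge sx.
    have [sb|sb] := boolP (0 < s < b); last by rewrite Q0// mul0r mulr0 normr0
        mul0r mulr0.
    have [s0 sb'] := andP sb.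
    have mD : measurable_fun (setT : set Rm) (fun t : R => `|t - u| < x - s) by meas_fun.
    rewrite !normrM (gtr0_norm b0).
    have -> : 2 * M * (b * `|Q s| * expR (c * s)) = `|Q s|
        * (2 * b * (M * expR (c * s))) by ring.
    rewrite ler_wpM2l//; apply: le_trans (kern_Rintegral_le (ltW s0) kk mD) _.
    by rewrite ler_wpM2r ?mulr_ge0 ?expR_ge0// ler_wpM2l// ltW.
  have iW := integZl (2 * M) iw.
  have iG : integ (fun s => Q s * \int[mu]_t (if `|t - u| < x - s then k (s, t) else 0)).
    apply: integ_dom iW le; apply: measurable_funM => //.
    apply: (@measurable_Rintegral _ _ _ (fun v : Rm * Rm => if `|v.2 - u|
        < x - v.1 then k (v.1, v.2) else 0)).
    by meas_fun.
  have := Rintegral_norm_le iG iW le; rewrite RintZ// => h.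
  have := hc x; have : 0 <= 2 * M by lra.
  nra.
- move=> x u xu; rewrite /kernJ /= (_ : (fun s => _) = fun=> 0) ?Rintegral_cst
    ?mul0r ?mulr0//.
  apply/funext => s; have [sb|sb] := boolP (0 < s < b); last by rewrite Q0// mul0r.
  rewrite (_ : (fun t => _) = fun=> 0) ?Rintegral_cst ?mul0r ?mulr0//.
  apply/funext => t; case: ifPn => // h; apply: ks; rewrite leNgt; apply/negP => ts.
  have := ler_distD t u 0; rewrite !subr0 (distrC u t) => h';
      have := le_lt_trans h' (ltrD h ts).
  by rewrite subrK ltNge xu.
Qed.

(** For s > 0 the condition |s - u| < x - s forces |u| < x. Inside the cone x > 0, so the weight is
    at least 1 and a constant bound suffices. *)
Lemma kern0_kern b Q (h : R) c : 0 <= c -> L2_itv b Q ->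
  kern c (`|h| + \int[mu]_s `|Q s|) (kern0 Q h).
Proof.
move=> c0 QL; have [mQ _ Q0] := QL; have iQ := L2_integ QL.
have supp x u : x <= `|u| -> kern0 Q h (x, u) = 0.
  move=> xu; rewrite /kern0 /= ltNge xu add0r (_ : (fun s => _) = fun=>
      0) ?Rintegral_cst ?mul0r ?mulr0//.
  apply/funext => s; have [sb|sb] := boolP (0 < s < b); last by rewrite Q0// if_same.
  case: ifPn => // hh; have [s0 _] := andP sb.
  have := ler_distD s u 0; rewrite !subr0 (distrC u s) (gtr0_norm s0) => h'.
  by move: h' hh xu; lra.
split => //; first exact: measurable_kern0.
move=> x u; have [xu|ux] := leP x `|u|.
  by rewrite supp// normr0 mulr_ge0 ?expR_ge0// addr_ge0// Rintegral_ge0.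
have x0 : 0 <= x := le_trans (normr_ge0 _) (ltW ux).
rewrite /kern0 /= ux normrM ger0_norm ?invr_ge0//.
have hi : `|\int[mu]_s (if `|s - u| < x - s then Q s else 0)| <= \int[mu]_s `|Q s|.
  apply: Rintegral_norm_le; [by apply: integ_if => //; meas_fun|exact: integ_norm|].
  by move=> s; case: ifP => // _; rewrite normr0.
have e1 : 1 <= expR (c * x) by rewrite -expR0 ler_expR mulr_ge0.
have := ler_normD h (\int[mu]_s (if `|s - u| < x - s then Q s else 0)).
have := normr_ge0 h; have := normr_ge0 (\int[mu]_s (if `|s - u| < x - s then Q s else 0)).
have : 0 <= (`|h| + \int[mu]_s `|Q s|) * (expR (c * x) - 1).
  by rewrite mulr_ge0 ?subr_ge0// addr_ge0// Rintegral_ge0.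
lra.
Qed.

End Kernel.

(** * Volterra operators seen through the cosine transform *)

Section Transform.
Context {R : realType}.
Local Notation mu := (@lebesgue_measure R).
Local Notation Rm := (measurableTypeR R).
Implicit Types (b x c lam M : R) (f g F G p q Q : R -> R).

Lemma integM_cos lam f : integ f -> integ (fun u => f u * cos (lam * u)).
Proof. by move=> fi; apply: (integ_bndM (M := 1) fi (measurable_cosZ lam)) => x;
    exact: cos_max. Qed.

Lemma integ_ball t a f : measurable_fun (setT : set Rm) f -> (forall u, `|f u| <= 1) ->
  integ (fun u => if `|t - u| < a then f u else 0).
Proof.
move=> mf f1; apply: (@integ_bounded _ _ (t - a) (t + a) 1); first by meas_fun.
- by move=> u; case: ifP => _; rewrite ?normr0.
- by move=> u; rewrite -ltr_distlC => /negbTE ->.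
Qed.

(** The right side is the first Picard correction to cos (lam x) under y 0 = 1 and y' 0 = h. The
    term in h comes from the ball about 0, and the potential from balls about s. *)
Lemma transform_kern0 b Q (h : R) lam x : lam != 0 -> L2_itv b Q ->
  \int[mu]_u (kern0 Q h (x, u) * cos (lam * u)) =
  h * sigma lam x + \int[mu]_s (sigma lam (x - s) * (Q s * cos (lam * s))).
Proof.
move=> l0 QL; have [mQ _ Q0] := QL; have iQ := L2_integ QL.
have mcos := measurable_cosZ lam.
pose f (z : Rm * Rm) := if `|z.2 - z.1| < x - z.2 then Q z.2 * cos (lam * z.1) else 0.
have mf : measurable_fun setT f by rewrite /f; meas_fun.
have dom u s : `|f (u, s)| <= (if - `|x| < u < `|x| then 1 else 0) * `|Q s|.
  rewrite /f /=; have [sb|sb] := boolP (0 < s < b); last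
      by rewrite Q0// mul0r if_same !normr0 mulr0.
  have [s0 _] := andP sb; case: ifPn => h1; last by rewrite normr0 mulr_ge0//; case: ifP.
  have -> : - `|x| < u < `|x|.
    rewrite -ltr_norml; have := ler_distD s u 0; rewrite !subr0 (distrC u s)
        (gtr0_norm s0).
    by have := ler_norm x; move: h1; lra.
  by rewrite mul1r normrM ler_piMr// cos_max.
have I1 := integ_itv (- `|x|) `|x|; have I2 := integ_norm iQ.
have fub := Rintegral_Fubini mf I1 I2 dom.
have ih : integ (fun u : R => (if `|0 - u| < x then cos (lam * u) else 0)).
  by apply: integ_ball => // u; exact: cos_max.
have iF := integ_Rintegral mf I1 I2 dom.
have -> : \int[mu]_u (kern0 Q h (x, u) * cos (lam * u)) =
   \int[mu]_u ((2^-1 * h) * (if `|0 - u| < x then cos (lam * u) else 0) + 2^-1 *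
       \int[mu]_s f (u, s)).
  apply: eq_Rintegral => u _; rewrite /kern0 /= mulrDr mulrDl; congr (_ + _).
    by rewrite distrC subr0; case: ifP => _; rewrite ?mulr0 ?mul0r// mulrA.
  rewrite -mulrA; congr (_ * _); rewrite mulrC -RintZ; last
      by apply: integ_if => //; meas_fun.
  by apply: eq_Rintegral => s _; rewrite /f /=; case: ifP => _; rewrite ?mulr0// mulrC.
rewrite (RintD (integZl _ ih) (integZl _ iF)) (RintZ _ ih) (RintZ _ iF) fub
    (Rintegral_ball_cos 0 x l0).
rewrite mulr0 cos0; congr (_ + _); first by field.
have i3 : integ (fun s => \int[mu]_u f (u, s)).
  apply: (@integ_Rintegral _ (fun z : Rm * Rm => f (z.2, z.1)) _ _ _ I2 I1) => [|s u].
    by apply: (measurableT_comp mf); meas_fun.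
  by rewrite mulrC; exact: dom.
rewrite -(RintZ _ i3); apply: eq_Rintegral => s _.
have -> : (fun u => f (u, s)) = (fun u => Q s * (if `|s - u| < x - s then cos
    (lam * u) else 0)).
  by apply/funext => u; rewrite /f /=; case: ifP => _; rewrite ?mulr0.
rewrite RintZ; last by apply: integ_ball => // u; exact: cos_max.
by rewrite (Rintegral_ball_cos s (x - s) l0); field.
Qed.

(** One step of the Volterra operator corresponds to one application of [kernJ]. Two exchanges are
    made, u with s and then, for fixed s, u with t, after which the ball formula evaluates the
    integral in u. *)
Lemma transform_kernJ b Q c M k lam x : lam != 0 -> 0 <= c -> 0 <= M ->
    L2_itv b Q -> kern c M k ->
  \int[mu]_u (kernJ Q k (x, u) * cos (lam * u)) =
  \int[mu]_s (sigma lam (x - s) * (Q s * \int[mu]_t (k (s, t) * cos (lam * t)))).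
Proof.
move=> l0 c0 M0 QL kk; have [mQ _ Q0] := QL; have iQ := L2_integ QL;
    have [mk kM ks] := kk.
have mcos := measurable_cosZ lam.
pose G (z : Rm * Rm) := \int[mu]_t (if `|t - z.1| < x - z.2 then k (z.2, t) else 0).
have mG : measurable_fun setT G.
  apply: (@measurable_Rintegral _ _ _ (fun w : (Rm * Rm) * Rm =>
      if `|w.2 - w.1.1| < x - w.1.2 then k (w.1.2, w.2) else 0)).
  by meas_fun.
pose f (z : Rm * Rm) := Q z.2 * G z * cos (lam * z.1).
have mf : measurable_fun setT f by rewrite /f; meas_fun.
pose C := 2 * b * (M * expR (c * b)).
have supp s t u : 0 < s -> `|t - u| < x - s -> `|x| <= `|u| -> k (s, t) = 0.
  move=> s0 h1 xu; apply: ks; rewrite leNgt; apply/negP => ts.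
  have := ler_distD t u 0; rewrite !subr0 (distrC u t); have := ler_norm x.
  by move: h1 xu ts; lra.
have GC s u : 0 < s < b -> `|G (u, s)| <= C.
  move=> /andP[s0 sb]; rewrite /G /=.
  have mD : measurable_fun (setT : set Rm) (fun t : R => `|t - u| < x - s) by meas_fun.
  apply: le_trans (kern_Rintegral_le (ltW s0) kk mD) _; rewrite /C.
  apply: ler_pM; rewrite ?mulr_ge0 ?expR_ge0 ?(ltW s0)//; first by lra.
  by rewrite ler_wpM2l// ler_expR ler_wpM2l// ltW.
have G0 s u : 0 < s -> `|x| <= `|u| -> G (u, s) = 0.
  move=> s0 xu; rewrite /G /= (_ : (fun t => _) = fun=> 0) ?Rintegral_cst ?mul0r//.
  by apply/funext => t; case: ifPn => // h; exact: supp xu.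
have I1 := integ_itv (- `|x|) `|x|; have I2 := integZl C (integ_norm iQ).
have dom u s : `|f (u, s)| <= (if - `|x| < u < `|x| then 1 else 0) * (C * `|Q s|).
  rewrite /f /=; have [sb|sb] := boolP (0 < s < b); last
      by rewrite Q0// !mul0r !normr0 !mulr0.
  have [s0 _] := andP sb; rewrite -ltr_norml; case: ltP => ux; last first.
    by rewrite G0// mulr0 mul0r normr0 mul0r.
  rewrite mul1r !normrM mulrAC -mulrA [leRHS]mulrC ler_wpM2l//.
  rewrite mulrC -[leRHS]mulr1; apply: ler_pM => //; [exact: GC|exact: cos_max].
have fub := Rintegral_Fubini mf I1 I2 dom.
have iF := integ_Rintegral mf I1 I2 dom.
have i3 : integ (fun s => \int[mu]_u f (u, s)).
  apply: (@integ_Rintegral _ (fun z : Rm * Rm => f (z.2, z.1)) _ _ _ I2 I1) => [|s u].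
    by apply: (measurableT_comp mf); meas_fun.
  by rewrite mulrC; exact: dom.
have -> : \int[mu]_u (kernJ Q k (x, u) * cos (lam * u)) =
   \int[mu]_u (2^-1 * \int[mu]_s f (u, s)).
  apply: eq_Rintegral => u _; rewrite /kernJ /= -mulrA; congr (_ * _);
      rewrite mulrC -RintZ; last first.
    apply: (integ_dom _ (integZl C (integ_norm iQ))) => [|s].
      by apply: measurable_funM => //; exact: (measurableT_comp mG (pair1_measurable u)).
    have [sb|sb] := boolP (0 < s < b); last by rewrite Q0// !mul0r !normr0 !mulr0.
    by rewrite normrM mulrC ler_wpM2r//; exact: GC.
  by apply: eq_Rintegral => s _; rewrite /f /= mulrC.
rewrite (RintZ _ iF) fub -(RintZ _ i3); apply: eq_Rintegral => s _.
have [sb|sb] := boolP (0 < s < b); last first.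
  rewrite Q0// mul0r mulr0 (_ : (fun u => _) = fun=> 0) ?Rintegral_cst ?mul0r ?mulr0//.
  by apply/funext => u; rewrite /f /= Q0// !mul0r.
have [s0 sb'] := andP sb.
pose g (z : Rm * Rm) := if `|z.2 - z.1| < x - s then k (s, z.2) * cos (lam * z.1) else 0.
have mg : measurable_fun setT g by rewrite /g; meas_fun.
have I3 := integZl (M * expR (c * b)) (integ_itv (- s) s).
have domg u t : `|g (u, t)| <= (if - `|x| < u < `|x| then 1 else 0) *
    (M * expR (c * b) * (if - s < t < s then 1 else 0)).
  rewrite /g /=; case: ifPn => h1; last by rewrite normr0 mulr_ge0//;
      [case: ifP|rewrite !mulr_ge0 ?expR_ge0//; case: ifP].
  rewrite -!ltr_norml; case: (ltP `|u| `|x|) => ux; last first.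
    by rewrite (supp _ _ _ s0 h1 ux) mul0r normr0 mul0r.
  case: ltP => ts; last by rewrite ks// mul0r normr0 !mulr0.
  rewrite mul1r mulr1 normrM -[leRHS]mulr1; apply: ler_pM => //; last exact: cos_max.
  exact: (kern_le_const _ c0 M0 kk (ltW sb')).
have fubg := Rintegral_Fubini mg I1 I3 domg.
have i4 : integ (fun t => k (s, t) * cos (lam * t)).
  apply: integM_cos; have := kern_integ (D := fun=> true) s kk => /= h;
      apply: h; exact: measurable_cst.
have E1 : \int[mu]_u f (u, s) = Q s * \int[mu]_u \int[mu]_t g (u, t).
  have ig := integ_Rintegral mg I1 I3 domg.
  rewrite -(RintZ _ ig); apply: eq_Rintegral => u _; rewrite /f /= -mulrA; congr (_ * _).
  rewrite /G /= mulrC -RintZ; last by apply: (kern_integ _ kk); meas_fun.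
  by apply: eq_Rintegral => t _; rewrite /g /=; case: ifP => _; rewrite ?mulr0// mulrC.
rewrite E1 fubg.
have E2 : \int[mu]_t \int[mu]_u g (u, t) = 2 * sigma lam (x - s) * \int[mu]_t
    (k (s, t) * cos (lam * t)).
  rewrite -(RintZ _ i4); apply: eq_Rintegral => t _.
  have -> : (fun u => g (u, t)) = (fun u => k (s, t) * (if `|t - u|
      < x - s then cos (lam * u) else 0)).
    by apply/funext => u; rewrite /g /=; case: ifP => _; rewrite ?mulr0.
  rewrite RintZ; last by apply: integ_ball => // u; exact: cos_max.
  by rewrite (Rintegral_ball_cos t (x - s) l0); ring.
by rewrite E2; field.
Qed.

End Transform.

(** * Summation of the kernels: the transformation operator *)

Section Series.
Context {R : realType}.
Local Notation mu := (@lebesgue_measure R).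
Local Notation Rm := (measurableTypeR R).
Implicit Types (b x c lam M : R) (f g F G p q Q : R -> R).

Definition transform (k : Rm * Rm -> R) (lam x : R) : R := \int[mu]_u
    (k (x, u) * cos (lam * u)).

Lemma kern_row_integ c M k s : kern c M k -> integ (fun t => k (s, t)).
Proof.
by move=> kk; have := kern_integ (D := fun=> true) s kk => /= h; apply: h;
    exact: measurable_cst.
Qed.

Lemma measurable_transform c M k lam : kern c M k -> measurable_fun
    (setT : set Rm) (transform k lam).
Proof.
move=> [mk _ _].
by apply: (@measurable_Rintegral _ _ _ (fun z : Rm * Rm => k z * cos
    (lam * z.2))); meas_fun.
Qed.

Lemma transform_le c M k lam x : 0 <= x -> kern c M k -> `|transform k lam x| <=
    2 * x * (M * expR (c * x)).
Proof.
move=> x0 kk; have [mk kM ks] := kk.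
have ki := kern_row_integ x kk.
have mT : measurable_fun (setT : set Rm) (fun=> true) by exact: measurable_cst.
have kk' : kern c M (fun z => `|k z|).
  split; first by meas_fun.
  - by move=> s t; rewrite normr_id.
  - by move=> s t st; rewrite ks// normr0.
apply: le_trans (kern_Rintegral_le x0 kk' mT) => /=.
apply: le_trans (ler_norm _).
apply: Rintegral_norm_le; [exact: integM_cos|exact: integ_norm|].
by move=> u; rewrite normrM ler_piMr// cos_max.
Qed.

Lemma sigma_norm_le lam a : lam != 0 -> `|sigma lam a| <= `|a|.
Proof.
move=> l0; have [a0|a0] := leP 0 a; first by rewrite (ger0_norm a0); exact: sigma_le.
by rewrite /sigma ltNge (ltW a0)/= normr0.
Qed.

Lemma volterra_integ b Q lam x (F : R -> R) M : lam != 0 -> 0 <= b -> L2_itv b Q ->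
  measurable_fun (setT : set Rm) F -> (forall s, 0 < s < b -> `|F s| <= M) ->
  integ (fun s => sigma lam (x - s) * (Q s * F s)).
Proof.
move=> l0 b0 QL mF FM; have [mQ _ Q0] := QL; have iQ := L2_integ QL.
have ms := measurable_sigma lam.
apply: (integ_dom _ (integZl ((`|x| + b) * M) (integ_norm iQ))) => [|s]; first
    by meas_fun.
have [sb|sb] := boolP (0 < s < b); last by rewrite Q0// mul0r mulr0 !normr0 mulr0.
have [s0 sb'] := andP sb.
have -> : (`|x| + b) * M * `|Q s| = (`|x| + b) * (`|Q s| * M) by ring.
rewrite !normrM; apply: ler_pM; rewrite ?mulr_ge0//; last by rewrite ler_wpM2l// FM.
apply: le_trans (sigma_norm_le _ l0) _; apply: le_trans (ler_normB _ _) _.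
by rewrite lerD2l gtr0_norm// ltW.
Qed.

Fixpoint kterm (Q : R -> R) (h : R) (n : nat) : Rm * Rm -> R :=
  if n is m.+1 then kernJ Q (kterm Q h m) else kern0 Q h.

Definition ksum (Q : R -> R) (h : R) (n : nat) (z : Rm * Rm) : R :=
    \sum_(i < n) kterm Q h i z.

(** The kernel is chosen before [lam] and the solution. It is the sum of the [kterm], whose partial
    sums have the Picard iterates as transforms. Since the solution is given and is compared with
    these iterates, the lemma also yields forward uniqueness. *)
Lemma kernel_exists b Q (h : R) : 0 < b -> L2_itv b Q ->
  exists c M K, [/\ 0 <= c, 0 <= M, kern c M K &
   forall lam (y y1 : R -> R), 0 < lam -> SL_system b Q lam y y1 -> y1 0 = h * y 0 ->
     forall x, 0 <= x <= b -> y x = y 0 * (cos (lam * x) + transform K lam x)].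
Proof.
move=> b0 QL; have [mQ _ Q0] := QL; have iQ := L2_integ QL.
have bQL : L2_itv b (fun s => b * Q s).
  have [_ Q2 _] := QL; split; first by meas_fun.
    by under eq_fun do rewrite exprMn; exact: integZl.
  by move=> s hs; rewrite Q0// mulr0.
have [c /ltW c0 hc'] := L2_weight bQL; have hc x := (hc' x).1.
pose M0 := `|h| + \int[mu]_s `|Q s|.
have M0_ge0 : 0 <= M0 by rewrite addr_ge0// Rintegral_ge0.
pose D := kterm Q h; pose Kn := ksum Q h.
have M2 n : 0 <= M0 / 2 ^+ n by rewrite divr_ge0// exprn_ge0.
have kD n : kern c (M0 / 2 ^+ n) (D n).
  elim: n => [|n IH]; first by rewrite expr0 divr1; exact: kern0_kern QL.
  rewrite exprSr invfM mulrA; exact: (kernJ_kern b0 (M2 n) QL hc IH).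
have KnS n z : Kn n.+1 z = Kn n z + D n z by rewrite /Kn /ksum big_ord_recr.
have Kn0 z : Kn 0%N z = 0 by rewrite /Kn /ksum big_ord0.
have mKn n : measurable_fun setT (Kn n).
  elim: n => [|n IH].
    by rewrite (_ : Kn 0%N = fun=> 0); [exact: measurable_cst|apply/funext].
  rewrite (_ : Kn n.+1 = fun z => Kn n z + D n z); last exact/funext.
  by have := kern_meas (kD n) => ?; meas_fun.
have geo z : Kn ^~ z @ \oo --> limn (Kn ^~ z) /\
   forall n, `|limn (Kn ^~ z) - Kn n z| <= 2 * (M0 * expR (c * z.1)) / 2 ^+ n.
  apply: geo_cvg => n; rewrite KnS addrC addKr; case: z => x u.
  by apply: le_trans (kern_le (kD n) x u) _; rewrite mulrAC.
pose K z := limn (Kn ^~ z).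
have kK : kern c (2 * M0) K.
  split.
  - by apply: (measurable_fun_cvg mKn) => z _; exact: (geo z).1.
  - by move=> x u; have := (geo (x, u)).2 0%N; rewrite Kn0 subr0 expr0 divr1 mulrA.
  - move=> x u xu; rewrite /K (_ : Kn ^~ (x, u) = fun=> 0) ?lim_cst//.
    apply/funext; elim => [|n IH]; first exact: Kn0.
    by rewrite KnS IH (kern_supp (kD n) xu) addr0.
exists c, (2 * M0), K; split => // [|lam y y1 l0 yS y10 x hx]; first by rewrite mulr_ge0.
have ln0 : lam != 0 by rewrite gt_eqF.
(* Picard iterates, defined by adding transforms; [Srec] recovers the Volterra recursion that they
   satisfy. *)
pose S := fix S n x := if n is m.+1 then S m x + transform (D m) lam x else cos (lam * x).
have mS n : measurable_fun (setT : set Rm) (S n).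
  by elim: n => [|n IH] /=; [meas_fun|have := measurable_transform lam (kD n) =>
      ?; meas_fun].
have SM n : exists M, forall s, 0 <= s <= b -> `|S n s| <= M.
  elim: n => [|n [M IH]]; first by exists 1 => s _; exact: cos_max.
  exists (M + 2 * b * (M0 / 2 ^+ n * expR (c * b))) => s hs /=; have [s0 sb] := andP hs.
  apply: le_trans (ler_normD _ _) _; apply: lerD; first exact: IH.
  apply: le_trans (transform_le lam s0 (kD n)) _.
  by apply: ler_pM; rewrite ?mulr_ge0 ?expR_ge0 ?M2// ?ler_wpM2l ?ler_expR ?ler_wpM2l.
have Srec n x' : S n.+1 x' = cos (lam * x') + h * sigma lam x' +
    \int[mu]_s (sigma lam (x' - s) * (Q s * S n s)).
  elim: n => [|n IH].
    by rewrite /= [transform _ _ _](transform_kern0 h x' ln0 QL) addrA.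
  rewrite [LHS]/= -/(S n.+1 x') IH -addrA; congr (_ + _).
  rewrite [transform _ _ _](transform_kernJ x' ln0 c0 (M2 n) QL (kD n)).
  have [M HM] := SM n.
  have i1 : integ (fun s => sigma lam (x' - s) * (Q s * S n s)).
    by apply: (volterra_integ (M := M) _ ln0 (ltW b0) QL) =>
        // s /andP[/ltW s0 /ltW sb]; apply: HM; rewrite s0.
  have i2 : integ (fun s => sigma lam (x' - s) * (Q s * transform (D n) lam s)).
    apply: (volterra_integ (M := 2 * b * (M0 / 2 ^+ n * expR (c * b))) _ ln0 (ltW b0) QL).
      exact: measurable_transform (kD n).
    move=> s /andP[/ltW s0 /ltW sb]; apply: le_trans (transform_le lam s0 (kD n)) _.
    by apply: ler_pM; rewrite ?mulr_ge0 ?expR_ge0 ?M2// ?ler_wpM2l ?ler_expR ?ler_wpM2l.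
  by rewrite -(RintD i1 i2); apply: eq_Rintegral => s _ /=; rewrite -mulrDr -mulrDr.
have [yA y1A] := yS.
have [My0 yM] := AC_restr_bnd yA; have my := AC_meas yA; have [My yM0 yM'] := AC_bnd yA.
(* Subtracting [Srec] from Duhamel's formula, the error satisfies the Volterra equation without its
   free terms. As |sigma| <= b on the range of integration, the weight for b Q halves the error at
   each step. *)
have err n x' : 0 <= x' <= b -> `|y x' - y 0 * S n x'| <= (My + `|y 0|) * expR
    (c * x') / 2 ^+ n.
  elim: n x' => [|n IH] x' hx'.
    have e1 : 1 <= expR (c * x') by rewrite -expR0 ler_expR mulr_ge0//; case/andP: hx'.
    rewrite expr0 divr1 /= (@le_trans _ _ (My + `|y 0|))//; last
        by rewrite ler_peMr// addr_ge0.
    apply: le_trans (ler_normB _ _) _; apply: lerD; first exact: yM'.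
    by rewrite normrM ler_piMr// cos_max.
  have [M HM] := SM n.
  have i1 : integ (fun s => sigma lam (x' - s) * (Q s * restr b y s)).
    by apply: (volterra_integ (M := My0) _ ln0 (ltW b0) QL).
  have i2 : integ (fun s => sigma lam (x' - s) * (Q s * S n s)).
    by apply: (volterra_integ (M := M) _ ln0 (ltW b0) QL) =>
        // s /andP[/ltW s0 /ltW sb]; apply: HM; rewrite s0.
  have E : y x' - y 0 * S n.+1 x' =
      \int[mu]_s (sigma lam (x' - s) * (Q s * restr b y s) - y 0 *
          (sigma lam (x' - s) * (Q s * S n s))).
    rewrite (RintB i1 (integZl _ i2)) (RintZ _ i2) Srec (duhamel l0 QL yS hx') y10.
    have -> : \int[mu]_s (sigma lam (x' - s) * (Q s * y s)) = \int[mu]_s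
        (sigma lam (x' - s) * (Q s * restr b y s)).
      apply: eq_Rintegral => s _; rewrite /restr; case: ifPn => // sb;
          by rewrite Q0// !mul0r.
    by rewrite !mulrDr !opprD; ring.
  have iw : integ (fun s => if s < x' then `|b * Q s| * expR (c * s) else 0).
    have ib : integ (fun s => `|b * Q s|) by apply: integ_norm; exact: L2_integ bQL.
    apply: (integ_dom _ (integZl (expR (c * x')) ib)) => [|s]; first by meas_fun.
    case: ifP => sx; last by rewrite normr0 mulr_ge0 ?expR_ge0.
    by rewrite normrM normr_id ger0_norm ?expR_ge0// mulrC ler_wpM2r// ler_expR
        ler_wpM2l// ltW.
  pose N := (My + `|y 0|) / 2 ^+ n.
  have N0 : 0 <= N by rewrite /N divr_ge0 ?addr_ge0// exprn_ge0.
  rewrite E; apply: (@le_trans _ _ (N * (expR (c * x') / 2))); last first.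
    by rewrite /N exprSr invfM !mulrA le_eqVlt; apply/orP; left; apply/eqP;
        field; rewrite expf_neq0.
  apply: le_trans (ler_wpM2l N0 (hc x')); rewrite -(RintZ _ iw).
  apply: Rintegral_norm_le; [by apply: integB => //; exact: integZl|exact: integZl|].
  move=> s; have [sb|sb] := boolP (0 < s < b); last first.
    by rewrite Q0// !mul0r !mulr0 subr0 normr0 mul0r if_same mulr0.
  have [s0 sb'] := andP sb; rewrite /restr sb.
  have -> : sigma lam (x' - s) * (Q s * y s) - y 0 * (sigma lam (x' - s) *
      (Q s * S n s)) =
    sigma lam (x' - s) * (Q s * (y s - y 0 * S n s)) by ring.
  case: (ltP s x') => sx; last first.
    by rewrite /sigma subr_gt0 ltNge sx/= mul0r normr0 mulr0.
  have hs : 0 <= s <= b by rewrite !ltW.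
  have h1 := IH s hs.
  have h2 : `|sigma lam (x' - s)| <= b.
    have xs : 0 <= x' - s by rewrite subr_ge0 ltW.
    by apply: le_trans (sigma_le ln0 xs) _; have := andP hx'; lra.
  rewrite !normrM (gtr0_norm b0).
  have -> : N * (b * `|Q s| * expR (c * s)) = b * (`|Q s|
      * ((My + `|y 0|) * expR (c * s) / 2 ^+ n)).
    by rewrite /N; ring.
  by apply: ler_pM => //; rewrite ler_wpM2l.
have SK n : cos (lam * x) + transform (Kn n) lam x = S n x.
  elim: n => [|n IH] /=.
    rewrite /transform (_ : (fun u => _) = fun=> 0) ?Rintegral_cst ?mul0r ?addr0//.
    by apply/funext => u; rewrite Kn0 mul0r.
  rewrite -IH -addrA; congr (_ + _); rewrite /transform.
  have iKn : integ (fun u => Kn n (x, u)).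
    (* The zero function is obtained as a cut-off of [Q] by an empty condition. *)
    elim: (n) => [|m IHm]; first by under eq_fun do rewrite Kn0;
        exact: (integ_if (D := fun=> false) _ iQ).
    by under eq_fun do rewrite KnS; apply: integD => //; exact: kern_row_integ (kD m).
  rewrite -RintD; [|exact: integM_cos|by apply: integM_cos; exact: kern_row_integ (kD n)].
  by apply: eq_Rintegral => u _; rewrite KnS mulrDl.
have iKn n : integ (fun u => Kn n (x, u)).
  elim: n => [|m IHm]; first by under eq_fun do rewrite Kn0;
      exact: (integ_if (D := fun=> false) _ iQ).
  by under eq_fun do rewrite KnS; apply: integD => //; exact: kern_row_integ (kD m).
have iK := kern_row_integ x kK.
have Kn_supp n x' (u : R) : x' <= `|u| -> Kn n (x', u) = 0.
  by move=> xu; elim: n => [|n IH]; rewrite ?Kn0// KnS IH (kern_supp (kD n) xu) addr0.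
have kdiff n : kern c (2 * M0 / 2 ^+ n) (fun z => K z - Kn n z).
  have := kern_meas kK; have := mKn n => ? ?; split; first by meas_fun.
  - by move=> x' u; apply: le_trans ((geo (x', u)).2 n) _; rewrite /= mulrA mulrAC.
  - by move=> x' u xu; rewrite (kern_supp kK xu) Kn_supp// subrr.
apply/eqP; rewrite -subr_eq0 -normr_le0; have [x0 _] := andP hx.
(* The first summand bounds the error of the n-th Picard iterate, the second the transform of the
   kernel remainder K - Kn n. *)
apply: (@le_half_pow _ _ ((My + `|y 0|) * expR (c * x) + `|y 0|
    * (2 * x * (2 * M0 * expR (c * x))))) => n.
have -> : y x - y 0 * (cos (lam * x) + transform K lam x) =
    (y x - y 0 * S n x) - y 0 * transform (fun z => K z - Kn n z) lam x.
  have -> : transform (fun z => K z - Kn n z) lam x =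
      transform K lam x - transform (Kn n) lam x.
    rewrite /transform -RintB; [|exact: integM_cos|exact: integM_cos].
    by apply: eq_Rintegral => u _; rewrite mulrBl.
  by rewrite -SK; ring.
rewrite mulrDl; apply: le_trans (ler_normB _ _) _; apply: lerD; first exact: err.
rewrite normrM; apply: le_trans (ler_wpM2l (normr_ge0 (y 0))
    (transform_le lam x0 (kdiff n))) _.
rewrite le_eqVlt; apply/orP; left; apply/eqP; field; rewrite expf_neq0//.
Qed.

End Series.

(** * Products of cosine transforms *)

Section Product.
Context {R : realType}.
Local Notation mu := (@lebesgue_measure R).
Local Notation Rm := (measurableTypeR R).
Implicit Types (a b x c lam M : R) (f g F G p q Q : R -> R).

Lemma integ_shift g a : integ g -> integ (fun u => g (u + a)).
Proof.
move=> gi; have := integ_affine a (oner_neq0 R) gi.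
by under eq_fun do rewrite mul1r.
Qed.

Lemma Rintegral_shift g a : integ g -> \int[mu]_u g (u + a) = \int[mu]_u g u.
Proof.
move=> gi; have := Rintegral_affine a (oner_neq0 R) gi.
by under eq_Rintegral do rewrite mul1r; rewrite normr1 invr1 mul1r.
Qed.

(** The product-to-sum formula, with the shift of the argument moved from the cosine to [g] by
    translation. *)
Lemma cos_transform_shift g lam a : integ g ->
  cos (lam * a) * \int[mu]_s (g s * cos (lam * s)) =
  \int[mu]_u (2^-1 * (g (u - a) + g (u + a)) * cos (lam * u)).
Proof.
move=> gi.
have i1 k : integ (fun s => g s * cos (lam * (s + k))).
  apply: (integ_bndM (M := 1) gi) => [|s]; [by meas_fun|exact: cos_max].
have -> : \int[mu]_u (2^-1 * (g (u - a) + g (u + a)) * cos (lam * u)) =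
   \int[mu]_u (2^-1 * (g (u - a) * cos (lam * u)) + 2^-1 * (g (u + a) * cos (lam * u))).
  by apply: eq_Rintegral => u _; ring.
have j1 : integ (fun u => g (u - a) * cos (lam * u)) by apply: integM_cos;
    exact: (integ_shift (- a)).
have j2 : integ (fun u => g (u + a) * cos (lam * u)) by apply: integM_cos;
    exact: (integ_shift a).
rewrite (RintD (integZl _ j1) (integZl _ j2)) !RintZ//.
have e1 := Rintegral_shift (- a) (i1 a); have e2 := Rintegral_shift a (i1 (- a)).
have -> : \int[mu]_u (g (u - a) * cos (lam * u)) = \int[mu]_s (g s * cos (lam * (s + a))).
  by rewrite -e1; apply: eq_Rintegral => u _; rewrite subrK.
have -> : \int[mu]_u (g (u + a) * cos (lam * u)) = \int[mu]_s (g s * cos (lam * (s - a))).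
  by rewrite -e2; apply: eq_Rintegral => u _; rewrite addrK.
rewrite -mulrDr -(RintD (i1 a) (i1 (- a))) -!RintZ; [|exact: integD|exact: integM_cos].
apply: eq_Rintegral => s _.
have -> : cos (lam * (s + a)) = cos (lam * s) * cos (lam * a) - sin
    (lam * s) * sin (lam * a).
  by rewrite mulrDr cosD.
have -> : cos (lam * (s - a)) = cos (lam * s) * cos (lam * a) + sin
    (lam * s) * sin (lam * a).
  by rewrite mulrBr cosB.
by field.
Qed.

(** [cos_transform_shift] with a = t, integrated against f t. The supports add up, so the resulting
    kernel lives in |u| < 2 x; this with the bound on [g] gives the domination for Fubini. *)
Lemma cos_transform_conv f g lam x N : integ f -> integ g -> 0 <= N ->
  (forall u, `|g u| <= N) -> (forall u, x <= `|u| -> f u = 0) -> (forall u, x <=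
      `|u| -> g u = 0) ->
  (\int[mu]_t (f t * cos (lam * t))) * \int[mu]_s (g s * cos (lam * s)) =
  \int[mu]_u (2^-1 * \int[mu]_t (f t * (g (u - t) + g (u + t))) * cos (lam * u)).
Proof.
move=> fi gi N0 gN fs gs; have mf := integ_measurable fi; have mg := integ_measurable gi.
pose F (z : Rm * Rm) := f z.2 * (2^-1 * (g (z.1 - z.2) + g (z.1 + z.2)) * cos
    (lam * z.1)).
have mF : measurable_fun setT F by rewrite /F; meas_fun.
have I1 := integZl N (integ_itv (- (2 * x)) (2 * x)); have I2 := integ_norm fi.
have dom u t : `|F (u, t)| <= N * (if - (2 * x) < u < 2 * x then 1 else 0) * `|f t|.
  rewrite /F /=; have [xt|tx] := leP x `|t|; first by rewrite fs// mul0r !normr0 mulr0.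
  rewrite -ltr_norml; have [ux|ux] := ltP `|u| (2 * x); last first.
    have h1 := ler_distD t u 0; have h2 := ler_distD (- t) u 0.
    rewrite !subr0 in h1; rewrite !subr0 opprK normrN in h2.
    rewrite !gs ?addr0 ?mulr0 ?mul0r ?mulr0 ?normr0//; lra.
  rewrite mulr1 normrM mulrC ler_wpM2r// normrM -[leRHS]mulr1; apply: ler_pM =>
      //; last exact: cos_max.
  rewrite normrM ger0_norm ?invr_ge0//.
  have := ler_normD (g (u - t)) (g (u + t)); have := gN (u - t); have := gN (u + t); lra.
have fub := Rintegral_Fubini mF I1 I2 dom.
have -> : (\int[mu]_t (f t * cos (lam * t))) * \int[mu]_s (g s * cos (lam * s)) =
  \int[mu]_t \int[mu]_u F (u, t).
  rewrite mulrC -RintZ; last exact: integM_cos.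
  apply: eq_Rintegral => t _.
  rewrite mulrC -mulrA (cos_transform_shift lam t gi) -RintZ//.
  apply: integM_cos; apply: integZl; apply: integD;
      [exact: (integ_shift (- t))|exact: (integ_shift t)].
rewrite -fub; apply: eq_Rintegral => u _.
rewrite -mulrA mulrCA mulrC -RintZ; last first.
  apply: (integ_bndM (M := 2 * N) fi) => [|t]; first by meas_fun.
  by apply: le_trans (ler_normD _ _) _; have := gN (u - t); have := gN (u + t); lra.
by apply: eq_Rintegral => t _; rewrite /F /=; ring.
Qed.

(** Expanding the product, the square of the cosine gives the two explicit terms, the cross terms
    are the transform of W = K + L shifted by x and - x, and the product of transforms is the
    convolution [I]. All of these are independent of [lam] and supported in |u| < 2 x. *)
Lemma product_kernel b c1 M1 K c2 M2 L : 0 < b -> 0 <= c1 -> 0 <= M1 -> 0 <=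
    c2 -> 0 <= M2 ->
  kern c1 M1 K -> kern c2 M2 L ->
  exists C (V : Rm * Rm -> R), [/\ 0 <= C, measurable_fun setT V,
    (forall x u, 0 < x < b -> `|V (x, u)| <= C),
    (forall x u : R, 0 < x -> 2 * x <= `|u| -> V (x, u) = 0) &
    forall lam x, 0 < x < b ->
      (cos (lam * x) + transform K lam x) * (cos (lam * x) + transform L lam x) =
      2^-1 + 2^-1 * cos (lam * (2 * x)) + transform V lam x].
Proof.
move=> b0 c10 M10 c20 M20 kK kL.
have mK := kern_meas kK; have mL := kern_meas kL.
pose N1 := M1 * expR (c1 * b); pose N2 := M2 * expR (c2 * b).
have N10 : 0 <= N1 by rewrite mulr_ge0 ?expR_ge0.
have N20 : 0 <= N2 by rewrite mulr_ge0 ?expR_ge0.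
pose W z := K z + L z.
have mW : measurable_fun setT W by rewrite /W; meas_fun.
pose I (z : Rm * Rm) := \int[mu]_t (K (z.1, t) * (L (z.1, z.2 - t) + L (z.1, z.2 + t))).
have mI : measurable_fun setT I.
  apply: (@measurable_Rintegral _ _ _ (fun w : (Rm * Rm) * Rm =>
      K (w.1.1, w.2) * (L (w.1.1, w.1.2 - w.2) + L (w.1.1, w.1.2 + w.2)))).
  by meas_fun.
pose V (z : Rm * Rm) := 2^-1 * (W (z.1, z.2 - z.1) + W (z.1, z.2 + z.1)) + 2^-1 * I z.
have KN x u : x < b -> `|K (x, u)| <= N1 by move=> xb;
    exact: (kern_le_const _ c10 M10 kK (ltW xb)).
have LN x u : x < b -> `|L (x, u)| <= N2 by move=> xb;
    exact: (kern_le_const _ c20 M20 kL (ltW xb)).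
have WN x u : x < b -> `|W (x, u)| <= N1 + N2.
  by move=> xb; apply: le_trans (ler_normD _ _) _; apply: lerD; [exact: KN|exact: LN].
have iK x := kern_row_integ x kK; have iL x := kern_row_integ x kL.
have iW x : integ (fun u => W (x, u)) by exact: integD.
have Ws (x u : R) : x <= `|u| -> W (x, u) = 0.
  by move=> xu; rewrite /W (kern_supp kK xu) (kern_supp kL xu) addr0.
have IN x u : 0 < x < b -> `|I (x, u)| <= 2 * b * (N1 * (2 * N2)).
  move=> /andP[x0 xb].
  have le t : `|K (x, t) * (L (x, u - t) + L (x, u + t))| <= N1 * (2 * N2) *
      (if - x < t < x then 1 else 0).
    rewrite -ltr_norml; case: ltP => tx; last by rewrite (kern_supp kK tx) mul0r
        normr0 mulr0.
    rewrite mulr1 normrM; apply: ler_pM => //; first exact: KN.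
    by apply: le_trans (ler_normD _ _) _; have := LN x (u - t) xb;
        have := LN x (u + t) xb; lra.
  have i1 := integZl (N1 * (2 * N2)) (integ_itv (- x) x).
  have i2 : integ (fun t => K (x, t) * (L (x, u - t) + L (x, u + t))).
    by apply: (integ_dom _ i1 le); meas_fun.
  apply: le_trans (Rintegral_norm_le i2 i1 le) _; rewrite RintZ; last exact: integ_itv.
  have an : - x <= x by lra.
  have -> := Rintegral_FTC an (@cst_continuous R R 1) (fun x => is_derive_id x (1 : R)).
  have h : 0 <= N1 * (2 * N2) by rewrite !mulr_ge0.
  by rewrite mulrC ler_wpM2r//; lra.
have Is (x u : R) : 2 * x <= `|u| -> I (x, u) = 0.
  move=> ux; rewrite /I /= (_ : (fun t => _) = fun=> 0) ?Rintegral_cst ?mul0r//.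
  apply/funext => t; have [xt|tx] := leP x `|t|; first by rewrite (kern_supp kK xt) mul0r.
  have h3 := ler_distD t u 0; have h4 := ler_distD (- t) u 0.
  rewrite !subr0 in h3; rewrite !subr0 opprK normrN in h4.
  have -> : L (x, u - t) = 0 by apply: (kern_supp kL); lra.
  have -> : L (x, u + t) = 0 by apply: (kern_supp kL); lra.
  by rewrite addr0 mulr0.
exists (N1 + N2 + 2^-1 * (2 * b * (N1 * (2 * N2)))), V; split.
- by rewrite addr_ge0 ?addr_ge0// !mulr_ge0// ?invr_ge0// ltW.
- by rewrite /V; meas_fun.
- move=> x u hx; have [x0 xb] := andP hx.
  rewrite /V; apply: le_trans (ler_normD _ _) _; apply: lerD.
    rewrite normrM ger0_norm ?invr_ge0//.
    have := ler_normD (W (x, u - x)) (W (x, u + x)); have := WN x (u - x) xb;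
        have := WN x (u + x) xb; rewrite /=; lra.
  by rewrite normrM ger0_norm ?invr_ge0// ler_wpM2l ?invr_ge0// IN.
- move=> x u x0 ux; rewrite /V /=.
  have h1 := ler_distD x u 0; have h2 := ler_distD (- x) u 0.
  rewrite !subr0 (gtr0_norm x0) in h1; rewrite !subr0 opprK normrN (gtr0_norm x0) in h2.
  by rewrite !Ws ?Is ?addr0 ?mulr0 ?add0r//; lra.
- move=> lam x hx; have [x0 xb] := andP hx.
  have e1 := cos_transform_shift lam x (iW x).
  have e2 := cos_transform_conv lam (iK x) (iL x) N20 (fun u => LN x u xb)
      (fun u => kern_supp kK (u := u)) (fun u => kern_supp kL (u := u)).
  have j1 : integ (fun u => 2^-1 * (W (x, u - x) + W (x, u + x)) * cos (lam * u)).
    by apply: integM_cos; apply: integZl; apply: integD;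
        [exact: (integ_shift (- x) (iW x))|exact: (integ_shift x (iW x))].
  have jI : integ (fun u => 2^-1 * I (x, u)).
    apply: integZl; apply: (@integ_bounded _ _ (- (2 * x)) (2 * x)
        (2 * b * (N1 * (2 * N2)))).
    - by meas_fun.
    - by move=> u; exact: IN.
    - by move=> u; rewrite -ltr_norml -leNgt; exact: Is.
  have -> : transform V lam x = \int[mu]_u (2^-1 * (W (x, u - x) + W (x, u + x))
      * cos (lam * u)) +
     \int[mu]_u (2^-1 * I (x, u) * cos (lam * u)).
    rewrite -RintD//; last exact: integM_cos.
    by apply: eq_Rintegral => u _; rewrite /V /= mulrDl.
  rewrite -e1 -e2.
  have -> : \int[mu]_s (W (x, s) * cos (lam * s)) = transform K lam x + transform L lam x.
    by rewrite /transform -RintD; [apply: eq_Rintegral => s _;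
        rewrite /W mulrDl|exact: integM_cos|exact: integM_cos].
  have -> : cos (lam * (2 * x)) = 2 * cos (lam * x) ^+ 2 - 1.
    by rewrite mulrCA mulr2n mulrDl mul1r cosD -!expr2 sin2cos2; ring.
  by rewrite -/(transform K lam x) -/(transform L lam x); field.
Qed.

End Product.

(** * Completeness of the exponential system *)

Section Completeness.
Context {R : realType}.
Local Notation mu := (@lebesgue_measure R).
Local Notation Rm := (measurableTypeR R).
Implicit Types (x M D : R) (a b lam : nat -> R) (s : seq nat) (f g F G p q Q : R -> R).

Lemma L2_Lfun (G : Rm -> R) : measurable_fun (setT : set Rm) G ->
    integ (fun x => G x ^+ 2) ->
  G \in Lfun mu 2%:E.
Proof.
move=> mG G2; rewrite inE; apply/andP; split; first by rewrite inE.
rewrite inE /= /finite_norm unlock /Lnorm poweR_lty//.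
have := integrableP _ _ _ G2 => -[_]; apply: le_lt_trans.
rewrite le_eqVlt; apply/orP; left; apply/eqP; apply: eq_integral => x _ /=.
by rewrite powR_mulrn// normrX.
Qed.

Lemma Lnorm2_lt (g : Rm -> R) (e : R) : 0 < e -> measurable_fun (setT : set Rm) g ->
  ('N[mu]_2%:E[EFin \o g] < e%:E)%E -> integ (fun x => g x ^+ 2) /\ \int[mu]_x
      (g x ^+ 2) <= e ^+ 2.
Proof.
move=> e0 mg ge.
have gL : g \in Lfun mu 2%:E.
  rewrite inE; apply/andP; split; first by rewrite inE.
  by rewrite inE /= /finite_norm (lt_le_trans ge)// leey.
have g2 := Lfun2_integrable_sqr gL; split=> //.
rewrite -lee_fin EFin_Rintegral//.
have -> : (\int[mu]_x (g x ^+ 2)%:E = 'N[mu]_2%:E[EFin \o g] `^ 2)%E.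
  rewrite poweR_Lnorm//; apply: eq_integral => x _ /=.
  by rewrite powR_mulrn// real_normK// num_real.
rewrite -powR_mulrn; last exact: ltW.
rewrite -poweR_EFin.
apply: gt0_ler_poweR => //; last exact: ltW.
  by rewrite in_itv/= leey Lnorm_ge0.
by rewrite in_itv/= leey lee_fin andbT ltW.
Qed.

Lemma ReD (z w : R[i]) : complex.Re (z + w) = complex.Re z + complex.Re w.
Proof. by case: z; case: w. Qed.

Lemma ImD (z w : R[i]) : complex.Im (z + w) = complex.Im z + complex.Im w.
Proof. by case: z; case: w. Qed.

Definition trig_comb (lam : nat -> R) (s : seq nat) (a b : nat -> R) (x : R) : R :=
  \sum_(n <- s) (a n * cos (lam n * x) + b n * sin (lam n * x)).

Lemma measurable_trig_comb lam s a b : measurable_fun (setT : set Rm)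
    (trig_comb lam s a b).
Proof.
elim: s => [|n s IH].
  by rewrite (_ : trig_comb _ _ _ _ = fun=> 0) //; apply/funext => x;
      rewrite /trig_comb big_nil.
rewrite (_ : trig_comb _ _ _ _ = fun x => (a n * cos (lam n * x) + b n * sin
    (lam n * x)) + trig_comb lam s a b x).
  by meas_fun.
by apply/funext => x; rewrite /trig_comb big_cons.
Qed.

Lemma trig_comb_bnd lam s a b : exists M, forall x, `|trig_comb lam s a b x| <= M.
Proof.
elim: s => [|n s [M IH]]; first by exists 0 => x; rewrite /trig_comb big_nil normr0.
exists (`|a n| + `|b n| + M) => x; rewrite /trig_comb big_cons.
apply: le_trans (ler_normD _ _) _; apply: lerD; last exact: IH.
apply: le_trans (ler_normD _ _) _; rewrite !normrM; apply: lerD; rewrite ler_piMr//.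
  exact: cos_max.
exact: sin_max.
Qed.

Lemma Re_exp_comb lam s (c c' : nat -> R[i]) x : complex.Re (exp_comb lam s c c' x) =
  trig_comb lam s (fun n => complex.Re (c n) + complex.Re (c' n)) (fun n =>
      complex.Im (c' n) - complex.Im (c n)) x.
Proof.
rewrite /exp_comb /trig_comb; elim: s => [|n s IH]; first by rewrite !big_nil.
rewrite !big_cons ReD IH; congr (_ + _); rewrite /expi cosN sinN.
by case: (c n) => p q; case: (c' n) => p' q' /=; ring.
Qed.

Lemma Im_exp_comb lam s (c c' : nat -> R[i]) x : complex.Im (exp_comb lam s c c' x) =
  trig_comb lam s (fun n => complex.Im (c n) + complex.Im (c' n)) (fun n =>
      complex.Re (c n) - complex.Re (c' n)) x.
Proof.
rewrite /exp_comb /trig_comb; elim: s => [|n s IH]; first by rewrite !big_nil.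
rewrite !big_cons ImD IH; congr (_ + _); rewrite /expi cosN sinN.
by case: (c n) => p q; case: (c' n) => p' q' /=; ring.
Qed.

Lemma even_sin_integral G (lam : R) : integ G -> (forall u, G (- u) = G u) ->
  \int[mu]_u (G u * sin (lam * u)) = 0.
Proof.
move=> iG Ge.
have i1 : integ (fun u => G u * sin (lam * u)).
  by apply: (integ_bndM (M := 1) iG) => [|u]; [meas_fun|exact: sin_max].
have n1 : (-1 : R) != 0 by rewrite oppr_eq0 oner_eq0.
have := Rintegral_affine 0 n1 i1; rewrite normrN1 invr1 mul1r.
have -> : \int[mu]_u (G (-1 * u + 0) * sin (lam * (-1 * u + 0))) =
    - 1 * \int[mu]_u (G u * sin (lam * u)).
  rewrite -RintZ//; apply: eq_Rintegral => u _.
  by rewrite addr0 !mulN1r Ge mulrN sinN mulrN.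
lra.
Qed.

Lemma trig_comb_orth G (I : set nat) lam s a b : integ G -> (forall u, G (- u) = G u) ->
  (forall n, I n -> \int[mu]_u (G u * cos (lam n * u)) = 0) -> [set` s] `<=` I ->
  \int[mu]_u (G u * trig_comb lam s a b u) = 0.
Proof.
move=> iG Ge Gc; elim: s => [|n s IH] sI.
  rewrite (_ : (fun u => _) = fun=> 0) ?Rintegral_cst ?mul0r//.
  by apply/funext => u; rewrite /trig_comb big_nil mulr0.
have i1 : integ (fun u => G u * sin (lam n * u)).
  by apply: (integ_bndM (M := 1) iG) => [|u]; [meas_fun|exact: sin_max].
have i2 : integ (fun u => G u * cos (lam n * u)) by exact: integM_cos.
have i3 : integ (fun u => G u * trig_comb lam s a b u).
  have [M HM] := trig_comb_bnd lam s a b.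
  by apply: (integ_bndM iG _ HM); exact: measurable_trig_comb.
have -> : \int[mu]_u (G u * trig_comb lam (n :: s) a b u) =
   \int[mu]_u ((a n * (G u * cos (lam n * u)) + b n * (G u * sin (lam n * u))) +
       G u * trig_comb lam s a b u).
  by apply: eq_Rintegral => u _; rewrite /trig_comb big_cons; ring.
rewrite (RintD (integD (integZl _ i2) (integZl _ i1)) i3) (RintD (integZl _ i2)
    (integZl _ i1)).
rewrite !RintZ// even_sin_integral// Gc; last by apply: sI; rewrite /= mem_head.
by rewrite !mulr0 !add0r IH// => m ms; apply: sI; rewrite /= in_cons orbC;
    move: ms => /= ->.
Qed.

Lemma normc_sqr (z : R[i]) : ComplexField.Normc.normc z ^+ 2 =
    complex.Re z ^+ 2 + complex.Im z ^+ 2.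
Proof. by case: z => p q /=; rewrite sqr_sqrtr// addr_ge0 ?sqr_ge0. Qed.

(** As G is real, the real part P of an approximating combination is at least as close to G. It is a
    trigonometric sum orthogonal to G, because evenness disposes of the sines. *)
Lemma complete_orth_zero D G (I : set nat) lam : integ G -> integ (fun u => G u ^+ 2) ->
  (forall u, G (- u) = G u) -> (forall u, ~~ (- D < u < D) -> G u = 0) ->
  (forall n, I n -> \int[mu]_u (G u * cos (lam n * u)) = 0) ->
  exp_complete (- D) D I lam -> \int[mu]_u (G u ^+ 2) = 0.
Proof.
move=> iG iG2 Ge Gs Gc comp; have mG := integ_measurable iG.
have rE (f : R -> R) : f \_ (`]- D, D[ : set R) =
    (fun x => if - D < x < D then f x else 0).
  apply/funext => x; rewrite patchE.
  have [h|h] := boolP (- D < x < D); first by rewrite mem_set//= in_itv.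
  by rewrite memNset//= in_itv/=; exact/negP.
have fL : in_CL2 `]- D, D[ (fun x => (G x)%:C%C).
  split; rewrite /in_L2 rE /=.
    rewrite (_ : (fun x => _) = G); first exact: L2_Lfun.
    by apply/funext => x; case: ifPn => // /Gs ->.
  rewrite (_ : (fun x => _) = fun=> 0); last by apply/funext => x; rewrite if_same.
  by apply: L2_Lfun => //; under eq_fun do rewrite expr0n; exact: integrable0.
have key (e : R) : 0 < e -> \int[mu]_u (G u ^+ 2) <= e ^+ 2.
  move=> e0; have [s [c [c' [sI]]]] := comp _ fL e e0.
  pose g x := if - D < x < D then ComplexField.Normc.normc
      ((G x)%:C%C - exp_comb lam s c c' x) else 0.
  pose P := trig_comb lam s (fun n => complex.Re (c n) + complex.Re (c' n))
      (fun n => complex.Im (c' n) - complex.Im (c n)).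
  pose Q := trig_comb lam s (fun n => complex.Im (c n) + complex.Im (c' n))
      (fun n => complex.Re (c n) - complex.Re (c' n)).
  have mP : measurable_fun (setT : set Rm) P by exact: measurable_trig_comb.
  have mQ : measurable_fun (setT : set Rm) Q by exact: measurable_trig_comb.
  have gE x : ComplexField.Normc.normc ((G x)%:C%C - exp_comb lam s c c' x) =
      Num.sqrt ((G x - P x) ^+ 2 + Q x ^+ 2).
    rewrite -[LHS]ger0_norm; last by case: (_ - _) => ? ? /=; exact: sqrtr_ge0.
    rewrite -sqrtr_sqr normc_sqr; congr Num.sqrt.
    rewrite /P /Q -Re_exp_comb -Im_exp_comb; case: (exp_comb _ _ _ _ _) => p q /=.
    by rewrite add0r sqrrN.
  have mg : measurable_fun (setT : set Rm) g.
    have ms : measurable_fun (setT : set Rm) (@Num.sqrt R).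
      by apply: continuous_measurable_fun; exact: sqrt_continuous.
    have m2 : measurable_fun (setT : set Rm) (fun x => (G x - P x) ^+ 2 + Q x ^+
        2) by meas_fun.
    rewrite (_ : g = fun x => if - D < x < D then Num.sqrt
        ((G x - P x) ^+ 2 + Q x ^+ 2) else 0).
      by apply: measurable_fun_ifT; [meas_fun|exact: (measurableT_comp ms m2)|].
    by apply/funext => x; rewrite /g gE.
  rewrite rE -/g => /(Lnorm2_lt e0 mg)[ig2 g2e].
  pose w x := if - D < x < D then G x - P x else 0.
  have mw : measurable_fun (setT : set Rm) w by rewrite /w; meas_fun.
  have wg x : `|w x ^+ 2| <= g x ^+ 2.
    rewrite /w /g; case: ifP => _; last by rewrite expr0n normr0.
    by rewrite ger0_norm ?sqr_ge0// gE sqr_sqrtr ?addr_ge0 ?sqr_ge0// lerDl sqr_ge0.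
  have iw2 : integ (fun x => w x ^+ 2) by apply: (integ_dom _ ig2 wg); meas_fun.
  have [M HM] := trig_comb_bnd lam s (fun n => complex.Re (c n) + complex.Re
      (c' n)) (fun n => complex.Im (c' n) - complex.Im (c n)).
  have iGP : integ (fun x => G x * P x) := integ_bndM iG mP HM.
  have GP0 : \int[mu]_x (G x * P x) = 0 by exact: trig_comb_orth sI.
  (* Since G is orthogonal to P, the left side is the integral of G ^ 2. Absorbing half of it bounds
     it by the integral of (G - P) ^ 2 on the interval, at most e ^ 2. *)
  have E1 : \int[mu]_x (G x ^+ 2 - G x * P x) <= \int[mu]_x
      (2^-1 * (G x ^+ 2 + w x ^+ 2)).
    apply: Rintegral_le; [exact: integB|by apply: integZl; exact: integD|].
    move=> x; rewrite /w; case: ifPn => h; last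
        by rewrite Gs// expr0n mul0r/= subrr addr0 mulr0.
    by have := sqr_ge0 (P x); nra.
  move: E1; rewrite (RintB iG2 iGP) GP0 subr0 (RintZ _ (integD iG2 iw2)) (RintD iG2 iw2).
  have := Rintegral_le iw2 ig2 (fun x => le_trans (ler_norm _) (wg x)).
  move: g2e; lra.
apply/eqP; rewrite eq_le; apply/andP; split; last by apply: Rintegral_ge0 =>
    x _; exact: sqr_ge0.
rewrite leNgt; apply/negP => h.
(* With this e, a positive integral would be at most half of itself. *)
have := key (Num.sqrt (\int[mu]_u (G u ^+ 2) / 2));
    rewrite sqrtr_gt0 sqr_sqrtr ?divr_ge0 ?(ltW h)//.
by rewrite divr_gt0// => /(_ isT); lra.
Qed.

End Completeness.

(** * Uniqueness *)

Section Final.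
Context {R : realType}.
Local Notation mu := (@lebesgue_measure R).
Local Notation Rm := (measurableTypeR R).
Implicit Types (x M D C : R) (r f g F G p q Q : R -> R).

Lemma Rintegral_eq0_ae f : integ f -> (forall x, 0 <= f x) -> \int[mu]_x f x = 0 ->
  {ae mu, forall x : Rm, f x = 0}.
Proof.
move=> fi f0 If; have mf := measurable_int mu fi.
have : (\int[mu]_x `|(f x)%:E| = 0)%E.
  under eq_integral do rewrite gee0_abs ?lee_fin//.
  by rewrite -EFin_Rintegral// If.
move/(ae_eq_integral_abs mu measurableT mf) => h.
by apply: (ae_mono h) => x /= /(_ Logic.I) [].
Qed.

Lemma integ_sqrD f g : measurable_fun (setT : set Rm) f -> measurable_fun
    (setT : set Rm) g ->
  integ (fun x => f x ^+ 2) -> integ (fun x => g x ^+ 2) -> integ (fun x =>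
      (f x + g x) ^+ 2).
Proof.
move=> mf mg fi gi; apply: (integ_dom _ (integD (integZl 2 fi) (integZl 2 gi)))
    => [|x]; first by meas_fun.
by rewrite ger0_norm ?sqr_ge0//; have := sqr_ge0 (f x - g x); nra.
Qed.

Lemma integ_mul_transform (d C lam : R) r (V : Rm * Rm -> R) :
  0 < d -> 0 <= C -> L2_itv d r -> measurable_fun setT V ->
  (forall x u, 0 < x < d -> `|V (x, u)| <= C) ->
  (forall x u : R, 0 < x -> 2 * x <= `|u| -> V (x, u) = 0) ->
  integ (fun x => r x * transform V lam x).
Proof.
move=> d0 C0 rL mV VC Vs; have [mr _ r0] := rL; have ir := L2_integ rL.
have mT : measurable_fun (setT : set Rm) (transform V lam).
  by apply: (@measurable_Rintegral _ _ _ (fun z : Rm * Rm => V z * cos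
      (lam * z.2))); meas_fun.
have iC := integZl C (integ_itv (- (2 * d)) (2 * d)).
apply: (integ_dom _ (integZl (\int[mu]_u (C * (if - (2 * d) < u < 2 * d then 1
    else 0))) (integ_norm ir))) => [|x].
  by meas_fun.
have [hx|hx] := boolP (0 < x < d); last by rewrite r0// mul0r normr0 mulr0.
have [x0 xd] := andP hx.
have dom u : `|V (x, u) * cos (lam * u)| <= C * (if - (2 * d) < u < 2 * d then 1 else 0).
  rewrite -ltr_norml; case: ltP => ud.
    by rewrite normrM; apply: ler_pM => //; [exact: VC|exact: cos_max].
  rewrite Vs ?mul0r ?normr0 ?mulr0//; apply: le_trans ud.
  by rewrite ler_pM2l// ltW.
rewrite normrM mulrC ler_wpM2r//; apply: Rintegral_norm_le => //.
by apply: (integ_dom _ iC dom); meas_fun.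
Qed.

(** Completeness yields G = 0 only almost everywhere. Gronwall's inequality is therefore applied not
    to r but to the tail integral [T] of |r|, in whose estimate the term |G| integrates to 0 and the
    inequality holds at every point. *)
Lemma volterra_completeness (d C : R) r (V : Rm * Rm -> R) (I : set nat)
    (lam : nat -> R) :
  0 < d -> 0 <= C -> L2_itv d r -> measurable_fun setT V ->
  (forall x u, 0 < x < d -> `|V (x, u)| <= C) ->
  (forall x u : R, 0 < x -> 2 * x <= `|u| -> V (x, u) = 0) ->
  (forall n, I n -> \int[mu]_x (r x * (2^-1 * cos (lam n * (2 * x)) + transform
      V (lam n) x)) = 0) ->
  exp_complete (- (2 * d)) (2 * d) I lam ->
  \int[mu]_x `|r x| = 0.
Proof.
move=> d0 C0 rL mV VC Vs orth comp.
have [mr r2 r0] := rL; have ir := L2_integ rL; have inr := integ_norm ir.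
pose B u := \int[mu]_x (r x * V (x, u)).
have mB : measurable_fun (setT : set Rm) B.
  apply: (@measurable_Rintegral _ _ _ (fun w : Rm * Rm => r w.2 * V (w.2,
      w.1))); by meas_fun.
have rV x u : `|r x * V (x, u)| <= C * `|r x|.
  have [hx|hx] := boolP (0 < x < d); last by rewrite r0// mul0r normr0 mulr0.
  by rewrite normrM mulrC ler_wpM2r// VC.
have irV u : integ (fun x => r x * V (x, u)).
  by apply: (integ_dom _ (integZl C inr) (fun x => rV x u)); meas_fun.
have BC u : `|B u| <= C * \int[mu]_x `|r x|.
  by rewrite -RintZ//; apply: Rintegral_norm_le => //; exact: integZl.
have Bs (u : R) : 2 * d <= `|u| -> B u = 0.
  move=> ud; rewrite /B (_ : (fun x => _) = fun=> 0) ?Rintegral_cst ?mul0r//.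
  apply/funext => x; have [hx|hx] := boolP (0 < x < d); last by rewrite r0// mul0r.
  by have [x0 xd] := andP hx; rewrite Vs// ?mulr0//; lra.
have iB : integ B.
  apply: (integ_bounded (M := C * \int[mu]_x `|r x|) (a := - (2 * d)) (b :=
      2 * d)) => // u.
  by rewrite -ltr_norml -leNgt; exact: Bs.
have iB2 : integ (fun u => B u ^+ 2).
  by under eq_fun do rewrite expr2; exact: integ_bndM iB mB BC.
have h0 : (2^-1 : R) != 0 by rewrite invr_eq0.
have n0 : (-1 : R) != 0 by rewrite oppr_eq0 oner_eq0.
(* The zero keeps the shape a * u + b of the affine change of variables. *)
pose rh (u : R) := r (2^-1 * u + 0).
have irh : integ rh := integ_affine 0 h0 ir.
have irh2 : integ (fun u => rh u ^+ 2) := integ_affine 0 h0 r2.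
have mrh := integ_measurable irh.
(* orth says that G0 is orthogonal to cos (lam n u); G is twice its even part. *)
pose G0 u := 4^-1 * rh u + B u.
have iG0 : integ G0 by apply: integD => //; exact: integZl.
have iG02 : integ (fun u => G0 u ^+ 2).
  apply: integ_sqrD => //; first by meas_fun.
  by under eq_fun do rewrite exprMn; exact: integZl.
have mG0 := integ_measurable iG0.
pose G u := G0 u + G0 (- u).
have negE f (u : R) : f (- u) = f (-1 * u + 0) by rewrite addr0 mulN1r.
have iG0n : integ (fun u => G0 (- u)) by under eq_fun do rewrite negE;
    exact: integ_affine.
have iG0n2 : integ (fun u => G0 (- u) ^+ 2).
  by under eq_fun do rewrite negE; exact: (integ_affine 0 n0 iG02).
have iG : integ G by exact: integD.
have mG := integ_measurable iG.
have iG2 : integ (fun u => G u ^+ 2) by apply: integ_sqrD => //;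
    exact: integ_measurable iG0n.
have Ge u : G (- u) = G u by rewrite /G opprK addrC.
have G0s (u : R) : 2 * d <= `|u| -> G0 u = 0.
  move=> ud; rewrite /G0 /rh Bs// addr0 r0 ?mulr0// addr0.
  by apply/negP => /andP[h1 h2]; move: ud; rewrite ger0_norm; lra.
have Gs (u : R) : ~~ (- (2 * d) < u < 2 * d) -> G u = 0.
  by rewrite -ltr_norml -leNgt => ud; rewrite /G !G0s ?normrN// addr0.
have G0cos n : I n -> \int[mu]_u (G0 u * cos (lam n * u)) = 0.
  move=> In.
  have i1 := integM_cos (lam n) irh; have i2 := integM_cos (lam n) iB.
  have -> : \int[mu]_u (G0 u * cos (lam n * u)) =
     \int[mu]_u (4^-1 * (rh u * cos (lam n * u)) + B u * cos (lam n * u)).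
    by apply: eq_Rintegral => u _; rewrite /G0; ring.
  rewrite (RintD (integZl _ i1) i2) RintZ//.
  have j1 : integ (fun x => r x * cos (lam n * (2 * x))).
    by apply: (integ_bndM (M := 1) ir) => [|x]; [meas_fun|exact: cos_max].
  (* The substitution u = 2 x gains a factor 2, so the coefficient 1/4 in [G0] becomes the 1/2 of
     the orthogonality relation. *)
  have -> : \int[mu]_u (rh u * cos (lam n * u)) = 2 * \int[mu]_x
      (r x * cos (lam n * (2 * x))).
    have := Rintegral_affine 0 h0 j1; rewrite ger0_norm ?invr_ge0// invrK => <-.
    by apply: eq_Rintegral => u _; rewrite /rh addr0 mulVKf.
  pose F (z : Rm * Rm) := r z.1 * V z * cos (lam n * z.2).
  have mF : measurable_fun setT F by rewrite /F; meas_fun.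
  have I2 := integZl C (integ_itv (- (2 * d)) (2 * d)).
  have dom x u : `|F (x, u)| <= `|r x| * (C * (if - (2 * d) < u < 2 * d then 1 else 0)).
    rewrite /F /=; have [hx|hx] := boolP (0 < x < d); last
        by rewrite r0// !mul0r !normr0 mul0r.
    rewrite -ltr_norml; case: ltP => ud; last first.
      have [x0 xd] := andP hx; rewrite Vs//; last by lra.
      by rewrite mulr0 mul0r normr0 !mulr0.
    rewrite mulr1 -mulrA normrM ler_wpM2l// normrM -[leRHS]mulr1;
        apply: ler_pM => //; first exact: VC.
    exact: cos_max.
  have fub := Rintegral_Fubini mF inr I2 dom.
  have FE x : \int[mu]_u F (x, u) = r x * transform V (lam n) x.
    have [hx|hx] := boolP (0 < x < d); last first.
      rewrite r0// mul0r (_ : (fun u => _) = fun=> 0) ?Rintegral_cst ?mul0r//.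
      by apply/funext => u; rewrite /F /= r0// !mul0r.
    have iV : integ (fun u => V (x, u) * cos (lam n * u)).
      apply: integM_cos; apply: (integ_bounded (M := C) (a := - (2 * d)) (b :=
          2 * d)) => [|u|u].
      - by meas_fun.
      - exact: VC.
      - rewrite -ltr_norml -leNgt => ud; have [x0 xd] := andP hx; apply: Vs => //.
        by apply: le_trans ud; rewrite ler_pM2l// ltW.
    by rewrite /transform -RintZ//; apply: eq_Rintegral => u _; rewrite /F /= mulrA.
  have -> : \int[mu]_u (B u * cos (lam n * u)) = \int[mu]_x (r x * transform V (lam n) x).
    transitivity (\int[mu]_u \int[mu]_x F (x, u)).
      apply: eq_Rintegral => u _; rewrite /B mulrC -RintZ//.
      by apply: eq_Rintegral => x _; rewrite /F /= mulrC.
    by rewrite -fub; apply: eq_Rintegral => x _; exact: FE.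
  have j2 := integ_mul_transform (lam n) d0 C0 rL mV VC Vs.
  have := orth n In.
  have -> : \int[mu]_x (r x * (2^-1 * cos (lam n * (2 * x)) + transform V (lam n) x)) =
     \int[mu]_x (2^-1 * (r x * cos (lam n * (2 * x))) + r x * transform V (lam n) x).
    by apply: eq_Rintegral => x _; ring.
  rewrite (RintD (integZl _ j1) j2) RintZ//; lra.
have Gcos n : I n -> \int[mu]_u (G u * cos (lam n * u)) = 0.
  move=> In; have i1 := integM_cos (lam n) iG0.
  have := Rintegral_affine 0 n0 i1; rewrite normrN1 invr1 mul1r (G0cos n In) => e2.
  have -> : \int[mu]_u (G u * cos (lam n * u)) =
     \int[mu]_u (G0 u * cos (lam n * u) + G0 (-1 * u + 0) * cos (lam n * (-1 * u + 0))).
    by apply: eq_Rintegral => u _; rewrite /G mulrDl addr0 mulN1r mulrN cosN.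
  by rewrite (RintD i1 (integ_affine 0 n0 i1)) e2 G0cos// addr0.
have G2z := complete_orth_zero iG iG2 Ge Gs Gcos comp.
have Gabs : \int[mu]_u `|G u| = 0.
  have ae := Rintegral_eq0_ae iG2 (fun x => sqr_ge0 _) G2z.
  rewrite (Rint_ae (g := fun=> 0)) ?Rintegral_cst ?mul0r//; first by meas_fun.
  by apply: (ae_mono ae) => x /eqP; rewrite sqrf_eq0 => /eqP ->; rewrite normr0.
have t0 : (2 : R) != 0 by [].
have iGt : integ (fun s => `|G (2 * s + 0)|) := integ_affine 0 t0 (integ_norm iG).
have Gt0 : \int[mu]_s `|G (2 * s + 0)| = 0.
  by rewrite (Rintegral_affine 0 t0 (integ_norm iG)) Gabs mulr0.
pose T v := \int[mu]_s (if v < s then `|r s| else 0).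
have iT v : integ (fun s => if v < s then `|r s| else 0) by apply: integ_if =>
    //; meas_fun.
have mT : measurable_fun (setT : set Rm) T.
  apply: (@measurable_Rintegral _ _ _ (fun w : Rm * Rm => if w.1 < w.2 then `|r
      w.2| else 0)); by meas_fun.
have TM v : `|T v| <= \int[mu]_s `|r s|.
  by apply: Rintegral_norm_le => // s; case: ifP => _; rewrite ?normr_id ?normr0.
(* Solving G (2 s) = r s / 4 + B (2 s) + B (- 2 s) for r s multiplies each [B] term by 4, and each
   is at most C T s. *)
pose p := restr d (fun=> 8 * C).
have pL : L2_itv d p by exact: L2_cst.
have BT (s : R) e : 0 < s -> `|e| = 2 * s -> `|B e| <= C * T s.
  move=> s0 es; rewrite -RintZ//; apply: Rintegral_norm_le => //; first exact: integZl.
  move=> x; case: ltP => sx; first exact: rV.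
  have [hx|hx] := boolP (0 < x < d); last by rewrite r0// mul0r normr0 mulr0.
  by have [x0 xd] := andP hx; rewrite Vs// ?mulr0 ?normr0// es; lra.
(* On s > 0 the identity G = 0 is a homogeneous Volterra equation for r. *)
have point (s : R) : 0 < s -> `|r s| <= 4 * `|G (2 * s + 0)| + 8 * C * T s.
  move=> s0.
  have s2 : `|2 * s| = 2 * s by rewrite gtr0_norm//; lra.
  have b1 := BT s (2 * s) s0 s2; have b2 := BT s (- (2 * s)) s0 (etrans (normrN _) s2).
  have e1 : rh (2 * s) = r s by rewrite /rh addr0 mulKf.
  have e2 : rh (- (2 * s)) = 0.
    by rewrite /rh addr0 mulrN mulKf// r0// oppr_gt0 ltNge (ltW s0).
  have -> : r s = 4 * G (2 * s + 0) - 4 * (B (2 * s) + B (- (2 * s))).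
    by rewrite addr0 /G /G0 e1 e2; field.
  have := ler_normB (4 * G (2 * s + 0)) (4 * (B (2 * s) + B (- (2 * s)))).
  have := ler_normD (B (2 * s)) (B (- (2 * s))).
  rewrite !normrM (ger0_norm (_ : 0 <= 4))//; lra.
have gr x : 0 <= x <= d -> T x <= \int[mu]_s (if x < s then `|p s| * T s else 0).
  move=> /andP[x0 xd].
  have ipT : integ (fun s => if x < s then `|p s| * T s else 0).
    apply: integ_if; first by meas_fun.
    by apply: (integ_bndM _ mT TM); apply: integ_norm; exact: L2_integ pL.
  have := Rintegral_le (iT x) (integD (integZl 4 iGt) ipT).
  rewrite (RintD (integZl 4 iGt) ipT) RintZ// Gt0 mulr0 add0r; apply => s.
  case: ltP => xs; last by rewrite addr0 mulr_ge0.
  have s0 : 0 < s := le_lt_trans x0 xs.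
  have [hs|hs] := boolP (0 < s < d); last
      by rewrite r0// normr0 addr_ge0 ?mulr_ge0// Rintegral_ge0// => t _;
      case: ifP.
  by rewrite /p /restr hs (ger0_norm (_ : 0 <= 8 * C)) ?mulr_ge0//; exact: point.
have T0 := gronwall_backward pL mT TM gr (x := 0).
apply/eqP; rewrite eq_le; apply/andP; split; last by apply: Rintegral_ge0.
have -> : \int[mu]_x `|r x| = T 0.
  apply: eq_Rintegral => s _; case: ltP => // s0; rewrite r0 ?normr0//.
  by rewrite ltNge s0.
by apply: T0; rewrite lexx ltW.
Qed.

(** * Eigenfunctions at a common eigenvalue *)

Definition real_eigen (d : R) (Q Q2 : R -> R) (h1 h2 a1 a2 lam : R)
    (u u1 v v1 : R -> R) : Prop :=
  [/\ SL_system d Q lam u u1 /\ SL_system (1 - d) Q2 lam v v1,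
      u1 0 = h1 * u 0 /\ v1 0 = h2 * v 0,
      v (1 - d) = a1 * u d,
      v1 (1 - d) + a1^-1 * u1 d + a2 * u d = 0 &
      (exists2 x, 0 <= x <= d & u x != 0) \/ (exists2 x, 0 <= x <= 1 - d & v x != 0)].

(** The equations and all boundary and matching conditions have real coefficients, so real and
    imaginary parts satisfy them separately; the part kept is one that is nonzero at the given
    point. *)
Lemma real_eigenfunctions (d : R) (q1 q2 : R -> R) (h1 h2 a1 a2 lam : R) :
  L2_itv d (restr d q1) -> L2_itv (1 - d) (restr (1 - d) q2) ->
  eigenvalue_L d q1 q2 h1 h2 a1 a2 (lam ^+ 2)%:C%C ->
  exists u u1 v v1, real_eigen d (restr d q1) (restr (1 - d) q2) h1 h2 a1 a2 lam
      u u1 v v1.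
Proof.
move=> L1 L2 [u [u' [v [v' [[uS vS] [ubc vbc] m1 m2 nz]]]]].
have [uR uI] := SL_solution_real L1 uS; have [vR vI] := SL_solution_real L2 vS.
have eqRI (z w : R[i]) : z = w -> complex.Re z = complex.Re w /\ complex.Im z =
    complex.Im w by move=> ->.
have [ub1 ub2] := eqRI _ _ ubc; have [vb1 vb2] := eqRI _ _ vbc.
have [m11 m12] := eqRI _ _ m1; have [m21 m22] := eqRI _ _ m2.
pose re := @complex.Re R; pose im := @complex.Im R.
have hr : [/\ re (u' 0) = h1 * re (u 0), re (v' 0) = h2 * re (v 0),
   re (v (1 - d)) = a1 * re (u d) & re (v' (1 - d)) + a1^-1 * re (u' d) + a2 *
       re (u d) = 0].
  move: ub1 vb1 m11 m21; rewrite /re; case: (u' 0) (u 0) (v' 0) (v 0)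
      (v (1 - d)) (u d) (v' (1 - d)) (u' d)
    => ? ? [? ?] [? ?] [? ?] [? ?] [? ?] [? ?] [? ?] /=; by split; lra.
have hi : [/\ im (u' 0) = h1 * im (u 0), im (v' 0) = h2 * im (v 0),
   im (v (1 - d)) = a1 * im (u d) & im (v' (1 - d)) + a1^-1 * im (u' d) + a2 *
       im (u d) = 0].
  move: ub2 vb2 m12 m22; rewrite /im; case: (u' 0) (u 0) (v' 0) (v 0)
      (v (1 - d)) (u d) (v' (1 - d)) (u' d)
    => ? ? [? ?] [? ?] [? ?] [? ?] [? ?] [? ?] [? ?] /=; by split; lra.
have nzRI (z : R[i]) : z != 0 -> re z != 0 \/ im z != 0.
  case: z => p q; rewrite /re /im /=; case: (eqVneq p 0) => [->|]; last by left.
  by case: (eqVneq q 0) => [->|]; [rewrite eqxx|right].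
have [r1 r2 r3 r4] := hr; have [i1 i2 i3 i4] := hi.
case: nz => [[x hx /nzRI[]] ?|[x hx /nzRI[]] ?].
- by exists (re \o u), (re \o u'), (re \o v), (re \o v'); split => //; left; exists x.
- by exists (im \o u), (im \o u'), (im \o v), (im \o v'); split => //; left; exists x.
- by exists (re \o u), (re \o u'), (re \o v), (re \o v'); split => //; right; exists x.
- by exists (im \o u), (im \o u'), (im \o v), (im \o v'); split => //; right; exists x.
Qed.

(** If u 0 = 0, the transformation operator gives u = 0 on [0, d]. The matching conditions then hand
    zero Cauchy data to v at 1 - d, and backward uniqueness annihilates v as well. *)
Lemma real_eigen_neq0 (d : R) Q Q2 (h1 h2 a1 a2 lam : R) (u u1 v v1 : R -> R) :
  0 < d -> d < 1 -> 0 < lam -> L2_itv d Q -> L2_itv (1 - d) Q2 ->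
  real_eigen d Q Q2 h1 h2 a1 a2 lam u u1 v v1 -> u 0 != 0.
Proof.
move=> d0 d1 l0 QL Q2L [[uS vS] [ubc vbc] m1 m2 nz]; apply/eqP => u00.
have [c [M [K [_ _ _ Kval]]]] := kernel_exists h1 d0 QL.
have hd : 0 <= d <= d by rewrite lexx ltW.
have u_eq0 x : 0 <= x <= d -> u x = 0.
  by move=> hx; rewrite (Kval _ _ _ l0 uS ubc x hx) u00 mul0r.
have u1d : u1 d = 0.
  have [_ u1A] := uS; rewrite (AC_val u1A hd) ubc u00 mulr0 add0r.
  rewrite (_ : (fun s => _) = fun=> 0) ?Rintegral_cst ?mul0r//.
  apply/funext => s; case: ifP => // _; rewrite /restr; case: ifPn => // /andP[s0 sd].
  by rewrite u_eq0 ?mulr0// !ltW.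
have vd : v (1 - d) = 0 by rewrite m1 u_eq0// mulr0.
have v1d : v1 (1 - d) = 0 by move: m2; rewrite u1d u_eq0// !mulr0 !addr0.
have d2 : 0 <= 1 - d by rewrite subr_ge0 ltW.
case: nz => -[x hx]; first by rewrite u_eq0// eqxx.
by rewrite (SL_system_backward d2 Q2L vS vd v1d hx) eqxx.
Qed.

(** At the matching point the Wronskians of the two components are opposite: the terms in a2 cancel
    by symmetry, and a1 cancels its inverse. The one on the second interval is 0 because both
    problems share the potential and h2 there. *)
Lemma real_eigen_orth (d : R) Q tQ Q2 (h1 th1 h2 a1 a2 lam : R)
    (u u1 v v1 tu tu1 tv tv1 : R -> R) :
  0 < d -> d < 1 -> a1 != 0 -> L2_itv d Q -> L2_itv d tQ -> L2_itv (1 - d) Q2 ->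
  real_eigen d Q Q2 h1 h2 a1 a2 lam u u1 v v1 ->
  real_eigen d tQ Q2 th1 h2 a1 a2 lam tu tu1 tv tv1 ->
  (th1 - h1) * (u 0 * tu 0) + \int[mu]_s ((tQ s - Q s) * (u s * tu s)) = 0.
Proof.
move=> d0 d1 a0 QL tQL Q2L [[uS vS] [ubc vbc] m1 m2 _] [[tuS tvS] [tubc tvbc] tm1 tm2 _].
have d2 : 0 <= 1 - d by rewrite subr_ge0 ltW.
have W1 := wronskian (ltW d0) QL tQL uS tuS.
have W2 := wronskian d2 Q2L Q2L vS tvS.
rewrite (_ : (fun s => (Q2 s - Q2 s) * (v s * tv s)) = fun=> 0) in W2; last first.
  by apply/funext => s; rewrite subrr mul0r.
rewrite Rintegral_cst// mul0r vbc tvbc m1 tm1 in W2.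
have -> : (th1 - h1) * (u 0 * tu 0) + \int[mu]_s ((tQ s - Q s) * (u s * tu s)) =
   u d * tu1 d - u1 d * tu d by rewrite W1 ubc tubc; ring.
have e1 : u1 d = - a1 * (v1 (1 - d) + a2 * u d).
  have : a1 * (v1 (1 - d) + a1^-1 * u1 d + a2 * u d) = 0 by rewrite m2 mulr0.
  by rewrite !mulrDr mulVKf//; lra.
have e2 : tu1 d = - a1 * (tv1 (1 - d) + a2 * tu d).
  have : a1 * (tv1 (1 - d) + a1^-1 * tu1 d + a2 * tu d) = 0 by rewrite tm2 mulr0.
  by rewrite !mulrDr mulVKf//; lra.
rewrite e1 e2; have : a1 * u d * tv1 (1 - d) - v1 (1 - d) * (a1 * tu d) = 0.
  by rewrite W2; ring.
lra.
Qed.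

End Final.

Theorem theorem4 (R : realType) (d : R) (q1 tq1 q2 : R -> R)
    (h1 th1 h2 a1 a2 : R) (I : set nat) (lam tlam : nat -> R)
    (d_gt0 : 0 < d) (d_lt : d < 2^-1) (a1_gt0 : 0 < a1)
    (q1L2 : in_L2 `]0, d[ q1) (tq1L2 : in_L2 `]0, d[ tq1)
    (q2L2 : in_L2 `]0, 1 - d[ q2)
    (lamP : eigenvalue_seq d q1 q2 h1 h2 a1 a2 lam)
    (tlamP : eigenvalue_seq d tq1 q2 th1 h2 a1 a2 tlam)
    (lam_eq : forall n, I n -> lam n = tlam n)
    (omega_eq : omega d q1 h1 = omega d tq1 th1)
    (complete : exp_complete (- (2 * d)) (2 * d) I lam) :
  {ae @lebesgue_measure R, forall x, x \in `]0, d[ -> q1 x = tq1 x} /\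
  h1 = th1.
Proof.
pose mu := @lebesgue_measure R.
have QL := in_L2_L2_itv q1L2; have tQL := in_L2_L2_itv tq1L2;
    have Q2L := in_L2_L2_itv q2L2.
set Q := restr d q1 in QL; set tQ := restr d tq1 in tQL;
    set Q2 := restr (1 - d) q2 in Q2L.
have a1n : a1 != 0 by rewrite gt_eqF.
have [c [M [K [c0 M0 kK Kval]]]] := kernel_exists h1 d_gt0 QL.
have [tc [tM [tK [tc0 tM0 ktK tKval]]]] := kernel_exists th1 d_gt0 tQL.
have [C [V [C0 mV VC Vs Vprod]]] := product_kernel d_gt0 c0 M0 tc0 tM0 kK ktK.
pose r s := tQ s - Q s.
have iQ := L2_integ QL; have itQ := L2_integ tQL.
have rL : L2_itv d r.
  have [mQ Q2i Q0] := QL; have [mtQ tQ2i tQ0] := tQL; split; first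
      by rewrite /r; meas_fun.
  - rewrite /r; under eq_fun do rewrite -mulN1r.
    apply: integ_sqrD => //; first by meas_fun.
    by under eq_fun do rewrite mulN1r sqrrN.
  - by move=> x hx; rewrite /r Q0// tQ0// subrr.
have ir := L2_integ rL.
(* The part of the relation at an eigenvalue that does not depend on [lam]. *)
have om : th1 - h1 + 2^-1 * \int[mu]_s r s = 0.
  have oq : h1 + 2^-1 * \int[mu]_s Q s = th1 + 2^-1 * \int[mu]_s tQ s.
    by move: omega_eq; rewrite /omega -!Rintegral_if.
  by rewrite (RintB itQ iQ); move: oq; lra.
have [lam_gt0 _ lamE] := lamP; have [_ _ tlamE] := tlamP.
have orth n : I n -> \int[mu]_x (r x * (2^-1 * cos (lam n * (2 * x)) + transform
    V (lam n) x)) = 0.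
  move=> In.
  have ev : eigenvalue_L d q1 q2 h1 h2 a1 a2 (lam n ^+ 2)%:C%C.
    have : range (fun n => (lam n ^+ 2)%:C%C) (lam n ^+ 2)%:C%C by exists n.
    by rewrite -lamE.
  have tev : eigenvalue_L d tq1 q2 th1 h2 a1 a2 (lam n ^+ 2)%:C%C.
    rewrite (lam_eq n In).
    have : range (fun n => (tlam n ^+ 2)%:C%C) (tlam n ^+ 2)%:C%C by exists n.
    by rewrite -tlamE.
  have [u [u1 [v [v1 E]]]] := real_eigenfunctions QL Q2L ev.
  have [tu [tu1 [tv [tv1 tE]]]] := real_eigenfunctions tQL Q2L tev.
  have d1 : d < 1 by lra.
  have u0 := real_eigen_neq0 d_gt0 d1 (lam_gt0 n) QL Q2L E.
  have tu0 := real_eigen_neq0 d_gt0 d1 (lam_gt0 n) tQL Q2L tE.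
  have := real_eigen_orth d_gt0 d1 a1n QL tQL Q2L E tE.
  have [[uS _] [ubc _] _ _ _] := E; have [[tuS _] [tubc _] _ _ _] := tE.
  pose P x := 2^-1 * cos (lam n * (2 * x)) + transform V (lam n) x.
  have [_ _ r0] := rL.
  have iP : integ (fun x => r x * P x).
    have i1 : integ (fun x => r x * (2^-1 * cos (lam n * (2 * x)))).
      apply: (integ_bndM (M := 2^-1) ir) => [|x]; first by meas_fun.
      by rewrite normrM ger0_norm ?invr_ge0// ler_piMr ?invr_ge0// cos_max.
    have := integD i1 (integ_mul_transform (lam n) d_gt0 C0 rL mV VC Vs).
    by under eq_fun do rewrite -mulrDr.
  have -> : \int[mu]_s ((tQ s - Q s) * (u s * tu s)) =
     \int[mu]_s (u 0 * tu 0 * (2^-1 * r s + r s * P s)).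
    apply: eq_Rintegral => s _; rewrite -/(r s).
    have [hs|hs] := boolP (0 < s < d); last by rewrite r0// !mul0r mulr0 addr0 mulr0.
    have hs' : 0 <= s <= d by case/andP: hs => /ltW -> /ltW ->.
    rewrite (Kval _ _ _ (lam_gt0 n) uS ubc s hs') (tKval _ _ _ (lam_gt0 n) tuS
        tubc s hs').
    rewrite mulrACA (Vprod _ _ hs) /P; ring.
  rewrite RintZ; last by apply: integD => //; exact: integZl.
  rewrite (RintD (integZl _ ir) iP) RintZ// => h.
  have := mulf_neq0 u0 tu0 => uu.
  (* Subtracting u 0 * tu 0 times [om] removes the constant term; the nonzero factor is then
     cancelled. *)
  have : u 0 * tu 0 * \int[mu]_x (r x * P x) = 0.
    have := congr1 (fun z => u 0 * tu 0 * z) om; move: h; rewrite mulr0 /=; lra.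
  by move/eqP; rewrite mulf_eq0 (negbTE uu) /= => /eqP.
have rz := volterra_completeness d_gt0 C0 rL mV VC Vs orth complete.
have rae := Rintegral_eq0_ae (integ_norm ir) (fun x => normr_ge0 _) rz.
split.
  apply: (ae_mono rae) => x /= /normr0_eq0; rewrite /r /Q /tQ /restr => h.
  rewrite in_itv/= => hx; move: h; rewrite hx => /eqP; rewrite subr_eq0 => /eqP ->//.
(* With the integral of r gone, [om] reduces to th1 = h1. *)
have : \int[mu]_s r s = 0.
  rewrite (Rint_ae (g := fun=> 0)) ?Rintegral_cst ?mul0r//; first exact: integ_measurable.
  by apply: (ae_mono rae) => x /= /normr0_eq0.
by move: om => /[swap] ->; lra.
Qed.
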